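(* Let $\mathcal M$ be a model of $\mathsf{WKL}_0+\mathsf{B}\Sigma^0_2$. Then, in $\mathcal M$, for every free $F_\sigma$-ideal $\mathcal J$ there is an integer-valued submeasure $\mu$ such that $\mathcal J=\mathrm{Fin}(\mu)$.
   Context: Everything is interpreted inside a (possibly nonstandard) model $\mathcal M$ of second-order arithmetic with first-order part $\mathbb N$: sets, functions, sequences, trees and reals belong to $\mathcal M$, ''finite'' means finite in the sense of $\mathcal M$, and ''class'' means a collection of sets of $\mathcal M$. $\mathcal P(\mathbb N)$ is the class of all subsets of $\mathbb N$ in $\mathcal M$, and $\mathcal P_{<\infty}(\mathbb N)$ is the set of (codes for) finite sets. A class $\mathcal J\subseteq\mathcal P(\mathbb N)$ is a free ideal if: (i) $X\subseteq Y$ and $Y\in\mathcal J$ imply $X\in\mathcal J$; (ii) for every $k\in\mathbb N$ and every sequence $X_0,\dots,X_k$ of elements of $\mathcal J$, $X_0\cup\dots\cup X_k\in\mathcal J$ (closure under all internally finite unions); (iii) $\{0,1,\dots,n\}\in\mathcal J$ for every $n\in\mathbb N$. For a binary tree $T\subseteq 2^{<\infty}$, $[T]$ is the class of sets whose characteristic function is a path through $T$. An $F_\sigma$ class is a class of the form $\bigcup_{i=0}^\infty[T_i]$ for some sequence $(T_i)_{i=0}^\infty$ (in $\mathcal M$) of binary trees; a free $F_\sigma$-ideal is a free ideal that is an $F_\sigma$ class. A (code for a lower semicontinuous) submeasure is a function $\mu:\mathcal P_{<\infty}(\mathbb N)\to\mathbb R$ with $\mu(\varnothing)=0$ and $\max(\mu(x),\mu(y))\le\mu(x\cup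 y)\le\mu(x)+\mu(y)$ for all finite sets $x,y$; it is integer-valued if all its values lie in $\mathbb N$. For $X\subseteq\mathbb N$, $\mu(X)<\infty$ means $\exists m\,\forall n\,\mu(X\cap\{0,\dots,n-1\})\le m$, and $\mathrm{Fin}(\mu)=\{X\subseteq\mathbb N:\mu(X)<\infty\}$. *)

(* Defs.v *)
(* Models of subsystems of second-order arithmetic as two-sorted
   Tarskian structures; conventions follow Simpson, "Subsystems of Second Order
   Arithmetic", unless a comment says otherwise. *)

Declare Scope so_scope.
Delimit Scope so_scope with so.

(* Both sorts are nonempty, as always in first-order semantics.  Equality of
   sets is not primitive: sets are only compared through membership. *)
Record L2_structure : Type := {
  num : Type;
  sets : Type;
  zero : num;
  one : num;
  add : num -> num -> num;
  mul : num -> num -> num;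
  nlt : num -> num -> Prop;
  mem : num -> sets -> Prop;
  sets_inhabited : inhabited sets
}.

Arguments zero {_}.
Arguments one {_}.
Arguments add {_} _ _.
Arguments mul {_} _ _.
Arguments nlt {_} _ _.
Arguments mem {_} _ _.

Bind Scope so_scope with num.
Notation "0" := zero : so_scope.
Notation "1" := one : so_scope.
Notation "2" := (add one one) : so_scope.
Notation "x + y" := (add x y) : so_scope.
Notation "x * y" := (mul x y) : so_scope.
Notation "x < y" := (nlt x y) : so_scope.

Open Scope so_scope.

Definition nle {M : L2_structure} (x y : num M) : Prop := x < y \/ x = y.
Notation "x <= y" := (nle x y) : so_scope.

Inductive term : Type :=
| tvar (n : nat)
| tzero
| tone
| tadd (s t : term)
| tmul (s t : term).

(* Sigma^0_0 formulas, number variables in de Bruijn style.  In [fall_lt t A]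
   and [fex_lt t A] the bound [t] lives outside the scope of the quantifier.
   Set variables are never quantified. *)
Inductive formula0 : Type :=
| feq (s t : term)
| flt (s t : term)
| fmem (t : term) (X : nat)
| fneg (A : formula0)
| fconj (A B : formula0)
| fdisj (A B : formula0)
| fimp (A B : formula0)
| fall_lt (t : term) (A : formula0)
| fex_lt (t : term) (A : formula0).

Definition scons {A : Type} (a : A) (rho : nat -> A) (n : nat) : A :=
  match n with
  | O => a
  | S k => rho k
  end.

Notation "a .: rho" := (scons a rho) (at level 55, right associativity) : so_scope.

Fixpoint eval {M : L2_structure} (rho : nat -> num M) (t : term) : num M :=
  match t with
  | tvar n => rho n
  | tzero => 0
  | tone => 1
  | tadd s u => eval rho s + eval rho u
  | tmul s u => eval rho s * eval rho u
  end.

Fixpoint sat {M : L2_structure} (sigma : nat -> sets M) (rho : nat -> num M)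
    (A : formula0) : Prop :=
  match A with
  | feq s t => eval rho s = eval rho t
  | flt s t => eval rho s < eval rho t
  | fmem t X => mem (eval rho t) (sigma X)
  | fneg B => ~ sat sigma rho B
  | fconj B C => sat sigma rho B /\ sat sigma rho C
  | fdisj B C => sat sigma rho B \/ sat sigma rho C
  | fimp B C => sat sigma rho B -> sat sigma rho C
  | fall_lt t B => forall x : num M, x < eval rho t -> sat sigma (x .: rho) B
  | fex_lt t B => exists x : num M, x < eval rho t /\ sat sigma (x .: rho) B
  end.

Record basic_axioms (M : L2_structure) : Prop := {
  ax_succ_neq0 : forall n : num M, n + 1 <> 0;
  ax_succ_inj : forall m n : num M, m + 1 = n + 1 -> m = n;
  ax_add0 : forall m : num M, m + 0 = m;
  ax_addS : forall m n : num M, m + (n + 1) = (m + n) + 1;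
  ax_mul0 : forall m : num M, m * 0 = 0;
  ax_mulS : forall m n : num M, m * (n + 1) = m * n + m;
  ax_lt0 : forall m : num M, ~ m < 0;
  ax_ltS : forall m n : num M, m < n + 1 <-> m < n \/ m = n
}.

(* The assignments [rho] and [sigma] supply the number and set parameters. *)
Definition Sigma01_induction (M : L2_structure) : Prop :=
  forall (theta : formula0) (sigma : nat -> sets M) (rho : nat -> num M),
    let phi n := exists a, sat sigma (a .: n .: rho) theta in
    phi 0 -> (forall n, phi n -> phi (n + 1)) -> forall n, phi n.

Definition Delta01_comprehension (M : L2_structure) : Prop :=
  forall (theta eta : formula0) (sigma : nat -> sets M) (rho : nat -> num M),
    let phi n := exists a, sat sigma (a .: n .: rho) theta in
    let psi n := forall a, sat sigma (a .: n .: rho) eta in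
    (forall n, phi n <-> psi n) ->
    exists X : sets M, forall n, mem n X <-> phi n.

Definition BSigma02 (M : L2_structure) : Prop :=
  forall (theta : formula0) (sigma : nat -> sets M) (rho : nat -> num M),
    let phi i j := exists a, forall b, sat sigma (b .: a .: j .: i .: rho) theta in
    forall n,
      (forall i, i < n -> exists j, phi i j) ->
      exists m, forall i, i < n -> exists j, j < m /\ phi i j.

Record RCA0 (M : L2_structure) : Prop := {
  RCA0_basic : basic_axioms M;
  RCA0_induction : Sigma01_induction M;
  RCA0_comprehension : Delta01_comprehension M
}.

Definition pair {M : L2_structure} (i j : num M) : num M :=
  (i + j) * (i + j) + i.

Definition divides {M : L2_structure} (d n : num M) : Prop :=
  exists q, n = d * q.

(* A number ((k,m),n) describes the finite set of all i < k such that
   m(i+1)+1 divides n; the code of a finite set is its least description. *)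
Definition is_triple {M : L2_structure} (c : num M) : Prop :=
  exists k m n, c = pair (pair k m) n.

Definition fin_mem {M : L2_structure} (i c : num M) : Prop :=
  exists k m n, c = pair (pair k m) n /\ i < k /\ divides (m * (i + 1) + 1) n.

Definition fincode {M : L2_structure} (c : num M) : Prop :=
  is_triple c /\
  forall d, d < c -> is_triple d -> ~ (forall i, fin_mem i d <-> fin_mem i c).

Definition codes {M : L2_structure} (c : num M) (P : num M -> Prop) : Prop :=
  fincode c /\ forall i, fin_mem i c <-> P i.

(* The binary string s of length l is coded by (l, c), where c is the code of
   {i < l : s(i) = 1}. *)
Definition is_string {M : L2_structure} (l c : num M) : Prop :=
  fincode c /\ forall i, fin_mem i c -> i < l.

Definition binary_tree {M : L2_structure} (T : num M -> Prop) : Prop :=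
  (forall s, T s -> exists l c, s = pair l c /\ is_string l c) /\
  (forall l c k d,
     T (pair l c) -> is_string k d -> k <= l ->
     (forall i, i < k -> (fin_mem i d <-> fin_mem i c)) ->
     T (pair k d)).

Definition path {M : L2_structure} (T : num M -> Prop) (X : sets M) : Prop :=
  forall n, exists c, codes c (fun i => i < n /\ mem i X) /\ T (pair n c).

Definition WKL (M : L2_structure) : Prop :=
  forall T : sets M,
    binary_tree (fun s => mem s T) ->
    (forall m, exists s, m < s /\ mem s T) ->
    exists X : sets M, path (fun s => mem s T) X.

Definition WKL0 (M : L2_structure) : Prop := RCA0 M /\ WKL M.

Definition section {M : L2_structure} (U : sets M) (i : num M) : num M -> Prop :=
  fun n => mem (pair i n) U.

Definition in_class {M : L2_structure} (J : sets M -> Prop) (P : num M -> Prop)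
  : Prop :=
  exists X : sets M, J X /\ forall n, mem n X <-> P n.

Record free_ideal {M : L2_structure} (J : sets M -> Prop) : Prop := {
  ideal_subset : forall X Y : sets M,
    (forall n, mem n X -> mem n Y) -> J Y -> J X;
  ideal_union : forall (k : num M) (U : sets M),
    (forall i, i <= k -> in_class J (section U i)) ->
    in_class J (fun n => exists i, i <= k /\ section U i n);
  ideal_initial : forall n : num M, in_class J (fun i => i <= n)
}.

Definition F_sigma {M : L2_structure} (J : sets M -> Prop) : Prop :=
  exists U : sets M,
    (forall i, binary_tree (section U i)) /\
    forall X : sets M, J X <-> exists i, path (section U i) X.

Definition free_F_sigma_ideal {M : L2_structure} (J : sets M -> Prop) : Prop :=
  free_ideal J /\ F_sigma J.

(* [Rat a b d] represents the rational (a - b) / (d + 1).  Representations need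
   not be reduced. *)
Record rat (M : L2_structure) : Type := Rat {
  rpos : num M;
  rneg : num M;
  rden : num M
}.

Arguments Rat {_} _ _ _.
Arguments rpos {_} _.
Arguments rneg {_} _.
Arguments rden {_} _.

Definition rat_code {M : L2_structure} (p : rat M) : num M :=
  pair (pair (rpos p) (rneg p)) (rden p).

Definition rat_le {M : L2_structure} (p q : rat M) : Prop :=
  rpos p * (rden q + 1) + rneg q * (rden p + 1) <=
  rpos q * (rden p + 1) + rneg p * (rden q + 1).

Definition rat_add {M : L2_structure} (p q : rat M) : rat M :=
  Rat (rpos p * (rden q + 1) + rpos q * (rden p + 1))
      (rneg p * (rden q + 1) + rneg q * (rden p + 1))
      (rden p * rden q + rden p + rden q).

(* Reals are Cauchy sequences of rationals with |x_k - x_(k+i)| <= 1/(k+1); the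
   rate 1/(k+1) replaces 2^(-k), which only changes representations.  Here
   sequences are functions of the metatheory; [represents] below restricts
   them to those coded in the model. *)
Definition is_real {M : L2_structure} (x : num M -> rat M) : Prop :=
  forall k i,
    rat_le (x k) (rat_add (x (k + i)) (Rat 1 0 k)) /\
    rat_le (x (k + i)) (rat_add (x k) (Rat 1 0 k)).

Definition real_le {M : L2_structure} (x y : num M -> rat M) : Prop :=
  forall k, rat_le (x k) (rat_add (y k) (Rat 2 0 k)).

Definition real_eq {M : L2_structure} (x y : num M -> rat M) : Prop :=
  real_le x y /\ real_le y x.

Definition real_add {M : L2_structure} (x y : num M -> rat M) : num M -> rat M :=
  fun k => rat_add (x (2 * k + 1)) (y (2 * k + 1)).

Definition real_of_num {M : L2_structure} (n : num M) : num M -> rat M :=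
  fun _ => Rat n 0 0.

(* A function from codes of finite sets to reals is a set [mu] of triples
   ((x,k),q), where q codes the k-th rational approximation to the value at
   x. *)
Definition represents {M : L2_structure} (mu : sets M) (x : num M)
    (r : num M -> rat M) : Prop :=
  forall k q, mem (pair (pair x k) q) mu <-> q = rat_code (r k).

Record submeasure {M : L2_structure} (mu : sets M) : Prop := {
  submeasure_real : forall x, fincode x ->
    exists r, represents mu x r /\ is_real r;
  submeasure_empty : forall x r,
    codes x (fun _ => False) -> represents mu x r ->
    real_eq r (real_of_num 0);
  (* max(mu(x), mu(y)) <= mu(x u y) <= mu(x) + mu(y) *)
  submeasure_union : forall x y z r s t,
    fincode x -> fincode y ->
    codes z (fun i => fin_mem i x \/ fin_mem i y) ->
    represents mu x r -> represents mu y s -> represents mu z t ->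
    real_le r t /\ real_le s t /\ real_le t (real_add r s)
}.

Definition integer_valued {M : L2_structure} (mu : sets M) : Prop :=
  forall x, fincode x ->
    exists r n, represents mu x r /\ real_eq r (real_of_num n).

Definition Fin {M : L2_structure} (mu : sets M) (X : sets M) : Prop :=
  exists m, forall n, exists x r,
    codes x (fun i => i < n /\ mem i X) /\ represents mu x r /\
    real_le r (real_of_num m).

(* Main.v *)
(* Let the ideal J be the union of the classes [T_j].  Call a set F k-thin if, for each
   of its elements a, the part of F up to a is contained in a string of length a + 1 of
   one of the trees T_j, j < k.  Thinness only looks at initial segments ending in an
   element of F, so it is decidable on finite sets and passes to subsets.  Let mu(x) be
   the least k such that the finite set x is covered by k sets that are k-thin.  It
   exists because x is contained in an initial segment, which lies in some [T_j], and
   it is subadditive because k + l covers can be concatenated.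

   If X is a path of T_j, every finite part of X is (j + 1)-thin, so mu is bounded on X.
   Conversely, if mu <= m on all finite parts of X, weak Koenig's lemma glues the finite
   covers into a cover of X by m sets that are m-thin.  Each such set D is in J: a bounded D
   is because J is free; if D is unbounded then, by Sigma_1 bounding, one T_j contains
   at every level a string including D up to that level, and weak Koenig's lemma gives
   a path of T_j that includes D.  So X is in J by closure under finite unions. *)

From Stdlib Require Import Classical Arith List Lia Ring.
Require Import Defs.

Section Model.
Context {M : L2_structure}.

(** * Definability *)

Definition env : Type := nat -> num M.

Inductive tm : (env -> num M) -> Prop :=
| tm_var n : tm (fun e => e n)
| tm_const a : tm (fun _ => a)
| tm_add f g : tm f -> tm g -> tm (fun e => f e + g e)
| tm_mul f g : tm f -> tm g -> tm (fun e => f e * g e).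

(* The relations defined by a [formula0] with parameters of both sorts, given as
   predicates of the environment so that Rocq variables act as parameters. *)
Inductive delta0 : (env -> Prop) -> Prop :=
| delta0_eq f g : tm f -> tm g -> delta0 (fun e => f e = g e)
| delta0_lt f g : tm f -> tm g -> delta0 (fun e => f e < g e)
| delta0_mem f X : tm f -> delta0 (fun e => mem (f e) X)
| delta0_not P : delta0 P -> delta0 (fun e => ~ P e)
| delta0_and P Q : delta0 P -> delta0 Q -> delta0 (fun e => P e /\ Q e)
| delta0_or P Q : delta0 P -> delta0 Q -> delta0 (fun e => P e \/ Q e)
| delta0_imp P Q : delta0 P -> delta0 Q -> delta0 (fun e => P e -> Q e)
| delta0_all_lt_scons f P : tm f -> delta0 P ->
    delta0 (fun e => forall x, x < f e -> P (x .: e))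
| delta0_ex_lt_scons f P : tm f -> delta0 P ->
    delta0 (fun e => exists x, x < f e /\ P (x .: e))
| delta0_iff P Q : (forall e, P e <-> Q e) -> delta0 P -> delta0 Q.

Definition e0 : env := fun _ => 0.

Definition prepend {A : Type} (l : list A) (e : nat -> A) : nat -> A :=
  fold_right scons e l.

Lemma prepend_app {A : Type} (l l' : list A) e :
  prepend (l ++ l') e = prepend l (prepend l' e).
Proof. exact (fold_right_app _ l l' e). Qed.

Lemma prepend_lt {A : Type} (l : list A) e e' n :
  Nat.lt n (length l) -> prepend l e n = prepend l e' n.
Proof.
  revert n; induction l as [|a l IH]; simpl; intros [|n] H; try lia; simpl; auto.
  apply IH; lia.
Qed.

Lemma prepend_ge {A : Type} (l : list A) e n :
  prepend l e (Nat.add (length l) n) = e n.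
Proof. induction l; simpl; auto. Qed.

(* [L0] holds the parameters collected so far and [L1] those of [f], while [l]
   is the list of values of the bound variables. *)
Lemma tm_term f : tm f -> forall L0, exists L1, forall d, exists t,
  forall R l, length l = d ->
    eval (prepend l (prepend L0 (prepend L1 R))) t = f (prepend l e0).
Proof.
  induction 1 as [n|a|f g _ IHf _ IHg|f g _ IHf _ IHg]; intros L0.
  - exists nil; intros d. destruct (Compare_dec.le_lt_dec d n) as [H|H].
    (* Past the bound variables the environment [e0] has the value 0. *)
    + exists tzero; intros R l Hl; simpl.
      replace n with (Nat.add (length l) (Nat.sub n d)) by lia.
      rewrite prepend_ge; reflexivity.
    + exists (tvar n); intros R l Hl; simpl. apply prepend_lt; lia.
  - exists (a :: nil); intros d.
    exists (tvar (Nat.add d (Nat.add (length L0) 0%nat))); intros R l <-; simpl.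
    rewrite !prepend_ge; reflexivity.
  - destruct (IHf L0) as [L1 H1], (IHg (L0 ++ L1)) as [L2 H2].
    exists (L1 ++ L2); intros d.
    destruct (H1 d) as [t Ht], (H2 d) as [u Hu].
    exists (tadd t u); intros R l Hl; simpl.
    rewrite prepend_app, Ht by assumption.
    rewrite <- (prepend_app L0), Hu by assumption. reflexivity.
  - destruct (IHf L0) as [L1 H1], (IHg (L0 ++ L1)) as [L2 H2].
    exists (L1 ++ L2); intros d.
    destruct (H1 d) as [t Ht], (H2 d) as [u Hu].
    exists (tmul t u); intros R l Hl; simpl.
    rewrite prepend_app, Ht by assumption.
    rewrite <- (prepend_app L0), Hu by assumption. reflexivity.
Qed.

(** Parameters of subformulas are concatenated, hence the quantification over the lists [L0], [S0]
    already in use and over the tails [R], [RS]. The new lists are chosen before the depth [d], so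
    they stay the same under a quantifier, where the depth is [S d]. *)
Lemma delta0_formula P : delta0 P -> forall L0 S0, exists L1 S1, forall d,
  exists A, forall R RS l, length l = d ->
    (sat (prepend S0 (prepend S1 RS)) (prepend l (prepend L0 (prepend L1 R))) A
     <-> P (prepend l e0)).
Proof.
  assert (H2 : forall (f g : env -> num M) (Q : num M -> num M -> Prop)
      (F : term -> term -> formula0),
    (forall s r t u, sat s r (F t u) <-> Q (eval r t) (eval r u)) ->
    tm f -> tm g -> forall L0 (S0 : list (sets M)), exists L1 S1, forall d,
    exists A, forall R RS l, length l = d ->
      (sat (prepend S0 (prepend S1 RS)) (prepend l (prepend L0 (prepend L1 R))) A
       <-> Q (f (prepend l e0)) (g (prepend l e0)))).
  { intros f g Q F HQ Hf Hg L0 S0.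
    destruct (tm_term _ Hf L0) as [L1 H1], (tm_term _ Hg (L0 ++ L1)) as [L2 H2].
    exists (L1 ++ L2), nil; intros d.
    destruct (H1 d) as [t Ht], (H2 d) as [u Hu].
    exists (F t u); intros R RS l Hl.
    rewrite HQ, (prepend_app L1), Ht by assumption.
    rewrite <- (prepend_app L0), Hu by assumption. reflexivity. }
  assert (H3 : forall (P1 P2 : env -> Prop) (Q : Prop -> Prop -> Prop)
      (F : formula0 -> formula0 -> formula0),
    (forall s r t u, sat s r (F t u) <-> Q (@sat M s r t) (sat s r u)) ->
    (forall p p' q q', p <-> p' -> q <-> q' -> Q p q <-> Q p' q') ->
    (forall L0 S0, exists L1 S1, forall d, exists A, forall R RS l, length l = d ->
      (sat (prepend S0 (prepend S1 RS)) (prepend l (prepend L0 (prepend L1 R))) A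
       <-> P1 (prepend l e0))) ->
    (forall L0 S0, exists L1 S1, forall d, exists A, forall R RS l, length l = d ->
      (sat (prepend S0 (prepend S1 RS)) (prepend l (prepend L0 (prepend L1 R))) A
       <-> P2 (prepend l e0))) ->
    forall L0 S0, exists L1 S1, forall d,
    exists A, forall R RS l, length l = d ->
      (sat (prepend S0 (prepend S1 RS)) (prepend l (prepend L0 (prepend L1 R))) A
       <-> Q (P1 (prepend l e0)) (P2 (prepend l e0)))).
  { intros P1 P2 Q F HF HQ IH1 IH2 L0 S0.
    destruct (IH1 L0 S0) as (L1 & S1 & H1).
    destruct (IH2 (L0 ++ L1) (S0 ++ S1)) as (L2 & S2 & H2').
    exists (L1 ++ L2), (S1 ++ S2); intros d.
    destruct (H1 d) as [A HA], (H2' d) as [B HB].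
    exists (F A B); intros R RS l Hl.
    rewrite HF; apply HQ.
    - rewrite !prepend_app; auto.
    - rewrite (prepend_app L1), (prepend_app S1), <- (prepend_app L0), <- (prepend_app S0).
      auto. }
  assert (H4 : forall (f : env -> num M) (P1 : env -> Prop)
      (Q : num M -> (num M -> Prop) -> Prop) (F : term -> formula0 -> formula0),
    (forall s r t B, sat s r (F t B) <-> Q (eval r t) (fun x => @sat M s (x .: r) B)) ->
    (forall a p p', (forall x, p x <-> p' x) -> Q a p <-> Q a p') ->
    tm f ->
    (forall L0 S0, exists L1 S1, forall d, exists A, forall R RS l, length l = d ->
      (sat (prepend S0 (prepend S1 RS)) (prepend l (prepend L0 (prepend L1 R))) A
       <-> P1 (prepend l e0))) ->
    forall L0 S0, exists L1 S1, forall d,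
    exists A, forall R RS l, length l = d ->
      (sat (prepend S0 (prepend S1 RS)) (prepend l (prepend L0 (prepend L1 R))) A
       <-> Q (f (prepend l e0)) (fun x => P1 (x .: prepend l e0)))).
  { intros f P1 Q F HF HQ Hf IH L0 S0.
    destruct (tm_term _ Hf L0) as [L1 H1].
    destruct (IH (L0 ++ L1) S0) as (L2 & S2 & H2').
    exists (L1 ++ L2), S2; intros d.
    destruct (H1 d) as [t Ht], (H2' (S d)) as [B HB].
    exists (F t B); intros R RS l Hl.
    rewrite HF, (prepend_app L1), Ht by assumption.
    apply HQ; intros x. rewrite <- (prepend_app L0).
    apply (HB R RS (x :: l)); simpl; congruence. }
  induction 1 as [f g Hf Hg|f g Hf Hg|f X Hf|P _ IHP|P Q _ IHP _ IHQ
    |P Q _ IHP _ IHQ|P Q _ IHP _ IHQ|f P Hf _ IHP|f P Hf _ IHP|P Q HPQ _ IHP].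
  - apply (H2 f g (fun x y => x = y) feq); simpl; tauto.
  - apply (H2 f g (fun x y => x < y) flt); simpl; tauto.
  - intros L0 S0. destruct (tm_term _ Hf L0) as [L1 H1].
    exists L1, (X :: nil); intros d. destruct (H1 d) as [t Ht].
    exists (fmem t (Nat.add (length S0) 0%nat)); intros R RS l Hl; simpl.
    rewrite Ht, prepend_ge by assumption. reflexivity.
  - intros L0 S0. destruct (IHP L0 S0) as (L1 & S1 & H1).
    exists L1, S1; intros d. destruct (H1 d) as [A HA].
    exists (fneg A); intros R RS l Hl; simpl. rewrite HA by assumption. reflexivity.
  - apply (H3 P Q and fconj); simpl; tauto.
  - apply (H3 P Q or fdisj); simpl; tauto.
  - apply (H3 P Q (fun p q => p -> q) fimp); simpl; tauto.
  - apply (H4 f P (fun a p => forall x, x < a -> p x) fall_lt); simpl; try tauto.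
    intros a p p' H; split; intros H' x Hx; apply H, H'; assumption.
  - apply (H4 f P (fun a p => exists x, x < a /\ p x) fex_lt); simpl; try tauto.
    intros a p p' H; split; intros (x & Hx & H'); exists x; split; auto; apply H, H'.
  - intros L0 S0. destruct (IHP L0 S0) as (L1 & S1 & H1).
    exists L1, S1; intros d. destruct (H1 d) as [A HA].
    exists A; intros R RS l Hl. rewrite HA by assumption. apply HPQ.
Qed.

(** [Delta01_comprehension] evaluates its two formulas under the same assignments, so the two
    predicates are translated with common parameters. *)
Lemma delta0_sat P Q : delta0 P -> delta0 Q -> exists A B sigma rho, forall a n,
  (sat sigma (a .: n .: rho) A <-> P (a .: n .: e0)) /\
  (sat sigma (a .: n .: rho) B <-> Q (a .: n .: e0)).
Proof.
  intros HP HQ. destruct (sets_inhabited M) as [X].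
  destruct (delta0_formula P HP nil nil) as (L1 & S1 & H1).
  destruct (delta0_formula Q HQ L1 S1) as (L2 & S2 & H2).
  destruct (H1 2%nat) as [A HA], (H2 2%nat) as [B HB].
  exists A, B, (prepend S1 (prepend S2 (fun _ => X))), (prepend L1 (prepend L2 e0)).
  intros a n; split.
  - exact (HA (prepend L2 e0) (prepend S2 (fun _ => X)) (a :: n :: nil) eq_refl).
  - exact (HB e0 (fun _ => X) (a :: n :: nil) eq_refl).
Qed.

(* In this form the quantifier rules apply by higher-order pattern unification. *)
Lemma delta0_all_lt f (P : num M -> env -> Prop) :
  tm f -> delta0 (fun e => P (e 0%nat) (fun n => e (S n))) ->
  delta0 (fun e => forall x, x < f e -> P x e).
Proof. exact (delta0_all_lt_scons f _). Qed.

Lemma delta0_ex_lt f (P : num M -> env -> Prop) :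
  tm f -> delta0 (fun e => P (e 0%nat) (fun n => e (S n))) ->
  delta0 (fun e => exists x, x < f e /\ P x e).
Proof. exact (delta0_ex_lt_scons f _). Qed.

(** * $\Sigma^0_1$ predicates and substitution of terms *)

Definition sigma1 (P : env -> Prop) : Prop :=
  exists Q, delta0 Q /\ forall e, P e <-> exists a, Q (a .: e).

Lemma tm_subst f (g : env -> env) :
  tm f -> (forall n, tm (fun e => g e n)) -> tm (fun e => f (g e)).
Proof. induction 1; intros; [auto|constructor; auto ..]. Qed.

Lemma tm_shift f : tm f -> tm (fun e => f (fun n => e (S n))).
Proof. intros Hf. apply (tm_subst f (fun e n => e (S n))); [assumption|constructor]. Qed.

Lemma delta0_subst P : delta0 P -> forall g : env -> env,
  (forall n, tm (fun e => g e n)) -> delta0 (fun e => P (g e)).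
Proof.
  (* Under a quantifier the substitution fixes variable 0 and is shifted on the others. *)
  assert (Hg' : forall g : env -> env, (forall n, tm (fun e => g e n)) ->
    forall n, tm (fun e => (e 0%nat .: g (fun k => e (S k))) n)).
  { intros g Hg [|n]; simpl; [constructor|]. apply (tm_shift (fun e => g e n)), Hg. }
  induction 1 as [f h Hf Hh|f h Hf Hh|f X Hf|P _ IHP|P Q _ IHP _ IHQ
    |P Q _ IHP _ IHQ|P Q _ IHP _ IHQ|f P Hf _ IHP|f P Hf _ IHP|P Q HPQ _ IHP];
    intros g Hg.
  1-3: constructor; apply tm_subst; assumption.
  1-4: constructor; auto.
  - apply (delta0_all_lt (fun e => f (g e)) (fun x e => P (x .: g e)));
      [apply tm_subst; assumption|].
    apply (IHP (fun e => e 0%nat .: g (fun n => e (S n)))), Hg', Hg.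
  - apply (delta0_ex_lt (fun e => f (g e)) (fun x e => P (x .: g e)));
      [apply tm_subst; assumption|].
    apply (IHP (fun e => e 0%nat .: g (fun n => e (S n)))), Hg', Hg.
  - apply (delta0_iff (fun e => P (g e))); [intros e; apply HPQ|auto].
Qed.

(** Classically [A] is equivalent to [0 = 0] or to its negation, so a subformula that mentions only
    parameters needs no analysis. *)
Lemma delta0_const (A : Prop) : delta0 (fun _ => A).
Proof.
  assert (H : delta0 (fun _ => (0 : num M) = 0)).
  { apply (delta0_eq (fun _ => 0) (fun _ => 0)); constructor. }
  destruct (classic A).
  - apply (delta0_iff _ _ (fun _ => conj (fun _ => H0) (fun _ => eq_refl)) H).
  - apply (delta0_iff (fun _ => ~ (0 : num M) = 0)); [tauto|].
    apply delta0_not, H.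
Qed.

Lemma sigma1_iff P Q : (forall e, P e <-> Q e) -> sigma1 P -> sigma1 Q.
Proof.
  intros H (R & HR & H'). exists R; split; [assumption|].
  intros e; rewrite <- H; apply H'.
Qed.

Lemma sigma1_delta0 P : delta0 P -> sigma1 P.
Proof.
  intros H. exists (fun e => P (fun n => e (S n))); split.
  - apply (delta0_subst P H (fun e n => e (S n))); constructor.
  - intros e; split; [intros H'; exists 0; exact H'|intros [a H']; exact H'].
Qed.

Lemma sigma1_ex_delta0 (P : num M -> env -> Prop) :
  delta0 (fun e => P (e 0%nat) (fun n => e (S n))) ->
  sigma1 (fun e => exists x, P x e).
Proof.
  intros H. exists (fun e => P (e 0%nat) (fun n => e (S n))); split; [assumption|].
  intros e; reflexivity.
Qed.

End Model.

(** * Automation for definability *)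

Ltac tm_step := cbv beta;
  first [apply tm_const | apply tm_var | apply tm_add | apply tm_mul].
Ltac tm := repeat tm_step.

(** A hook, redefined whenever further predicates have been shown to be $\Delta^0_0$. *)
Ltac delta0_atom := fail.

Ltac delta0_step := cbv beta;
  first [apply delta0_const | apply delta0_eq; [solve [tm]|solve [tm]]
    | apply delta0_lt; [solve [tm]|solve [tm]]
    | apply delta0_mem; solve [tm]
    | apply delta0_all_lt; [solve [tm]|] | apply delta0_ex_lt; [solve [tm]|]
    | delta0_atom | apply delta0_not | apply delta0_and | apply delta0_or | apply delta0_imp ].
Ltac delta0 := repeat delta0_step.

(** * Arithmetic *)

Section Arithmetic.
Context {M : L2_structure} (HM : RCA0 M).
Local Notation env := (@env M).
Implicit Types (a b c d k m n x y z : num M) (P Q : env -> Prop) (f : env -> num M).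

Lemma induction (P : num M -> Prop) :
  sigma1 (fun e => P (e 0%nat)) -> P 0 -> (forall n, P n -> P (n + 1)) -> forall n, P n.
Proof.
  intros (Q & HQ & H) H0 HS.
  destruct (delta0_sat Q Q HQ HQ) as (A & B & sigma & rho & HA).
  assert (H' : forall n, P n <-> exists a, sat sigma (a .: n .: rho) A).
  { intros n; rewrite (H (n .: e0)). split; intros [a Ha]; exists a; apply (proj1 (HA a n)), Ha. }
  intros n; apply H'; generalize n; apply (RCA0_induction M HM); clear n.
  - apply H', H0.
  - intros n Hn; apply H', HS, H', Hn.
Qed.

Let HB := RCA0_basic M HM.
Let add_0 := ax_add0 M HB.
Let add_S := ax_addS M HB.
Let mul_0 := ax_mul0 M HB.
Let mul_S := ax_mulS M HB.

Lemma add_assoc a b c : a + (b + c) = a + b + c.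
Proof.
  revert c; apply induction.
  - apply sigma1_delta0; delta0.
  - rewrite !add_0; reflexivity.
  - intros c H; rewrite !add_S, H; reflexivity.
Qed.

Lemma add_0_l a : 0 + a = a.
Proof.
  revert a; apply induction.
  - apply sigma1_delta0; delta0.
  - apply add_0.
  - intros c H; rewrite add_S, H; reflexivity.
Qed.

Lemma add_1_l a : 1 + a = a + 1.
Proof.
  revert a; apply induction.
  - apply sigma1_delta0; delta0.
  - rewrite add_0, add_0_l; reflexivity.
  - intros c H; rewrite add_S, H; reflexivity.
Qed.

Lemma add_comm a b : a + b = b + a.
Proof.
  revert b; apply induction.
  - apply sigma1_delta0; delta0.
  - rewrite add_0, add_0_l; reflexivity.
  - intros c H. rewrite add_S, H, <- !add_assoc, add_1_l; reflexivity.
Qed.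

Lemma mul_0_l a : 0 * a = 0.
Proof.
  revert a; apply induction.
  - apply sigma1_delta0; delta0.
  - apply mul_0.
  - intros c H. rewrite mul_S, H, add_0; reflexivity.
Qed.

Lemma mul_add_r a b c : a * (b + c) = a * b + a * c.
Proof.
  revert c; apply induction.
  - apply sigma1_delta0; delta0.
  - rewrite mul_0, !add_0; reflexivity.
  - intros c H. rewrite add_S, !mul_S, H, add_assoc; reflexivity.
Qed.

Lemma mul_1_l a : 1 * a = a.
Proof.
  revert a; apply induction.
  - apply sigma1_delta0; delta0.
  - apply mul_0.
  - intros c H. rewrite mul_S, H; reflexivity.
Qed.

Lemma mul_comm a b : a * b = b * a.
Proof.
  revert b; apply induction.
  - apply sigma1_delta0; delta0.
  - rewrite mul_0, mul_0_l; reflexivity.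
  - intros b H. rewrite mul_S, H. revert a H.
    assert (H : forall a, b * a + a = (b + 1) * a); [|intros; apply H].
    apply induction.
    + apply sigma1_delta0; delta0.
    + rewrite !mul_0, add_0; reflexivity.
    + intros a H. rewrite !mul_S, <- H, <- !add_assoc. f_equal.
      rewrite !add_assoc, (add_comm a b); reflexivity.
Qed.

Lemma mul_assoc a b c : a * (b * c) = a * b * c.
Proof.
  revert c; apply induction.
  - apply sigma1_delta0; delta0.
  - rewrite !mul_0; reflexivity.
  - intros c H. rewrite !mul_S, mul_add_r, H; reflexivity.
Qed.

Lemma num_semi_ring : semi_ring_theory (0 : num M) 1 add mul eq.
Proof.
  split; auto using add_0_l, add_comm, add_assoc, mul_1_l, mul_0_l, mul_comm, mul_assoc.
  intros a b c. rewrite mul_comm, mul_add_r, (mul_comm c a), (mul_comm c b); reflexivity.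
Qed.

Add Ring num_ring : num_semi_ring.

(** * Cancellation, the linear order and the least number principle *)

Lemma add_cancel_l a b c : a + b = a + c -> b = c.
Proof.
  revert a; apply (induction (fun a => a + b = a + c -> b = c)).
  - apply sigma1_delta0; delta0.
  - rewrite !add_0_l; auto.
  - intros a H H'. apply H, (ax_succ_inj M HB).
    transitivity (a + 1 + b); [ring|]. rewrite H'; ring.
Qed.

Lemma num_cases a : a = 0 \/ exists b, a = b + 1.
Proof.
  revert a; apply (induction (fun a => a = 0 \/ exists b, a = b + 1)).
  - apply (sigma1_iff (fun e => exists b, e 0%nat = 0 \/ e 0%nat = b + 1)).
    + intros e; split.
      * intros [b [H|H]]; eauto.
      * intros [H|[b H]]; [exists 0|exists b]; auto.
    + apply sigma1_ex_delta0; delta0.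
  - auto.
  - intros a _; eauto.
Qed.

(** The axioms describe [<] only by recursion on its right argument; with the difference [z]
    available, order facts become identities for [ring]. *)
Lemma lt_iff x y : x < y <-> exists z, y = x + z + 1.
Proof.
  split.
  - revert y; apply (induction (fun y => x < y -> exists z, y = x + z + 1)).
    (* The existential is pulled in front of the implication to exhibit a $\Sigma^0_1$ predicate; if
       the premise fails, any witness does. *)
    + apply (sigma1_iff (fun e => exists z, x < e 0%nat -> e 0%nat = x + z + 1)).
      * intros e; split; [intros [z H] H'; eauto|].
        intros H. destruct (classic (x < e 0%nat)) as [H'|H'].
        -- destruct (H H') as [z Hz]; eauto.
        -- exists 0; tauto.
      * apply sigma1_ex_delta0; delta0.
    + intros H; destruct (ax_lt0 M HB _ H).
    + intros y IH H. apply (ax_ltS M HB) in H as [H| ->].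
      * destruct (IH H) as [z ->]. exists (z + 1); ring.
      * exists 0; ring.
  - intros [z ->]. revert z; apply induction.
    + apply sigma1_delta0; delta0.
    + apply (ax_ltS M HB); right; ring.
    + intros z H. apply (ax_ltS M HB); left. rewrite add_assoc; assumption.
Qed.

Lemma le_iff x y : x <= y <-> exists z, y = x + z.
Proof.
  unfold nle; rewrite lt_iff; split.
  - intros [[z ->]| ->]; [exists (z + 1)|exists 0]; ring.
  - intros [z ->]. destruct (num_cases z) as [->|[u ->]]; [right|left; exists u]; ring.
Qed.


Lemma lt_succ x y : x < y + 1 <-> x <= y.
Proof. apply (ax_ltS M HB). Qed.

Lemma succ_neq_0 x : x + 1 <> 0.
Proof. apply (ax_succ_neq0 M HB). Qed.

Lemma lt_irrefl x : ~ x < x.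
Proof.
  rewrite lt_iff; intros [z H]. apply (succ_neq_0 z), (add_cancel_l x).
  transitivity (x + z + 1); [ring|rewrite <- H; ring].
Qed.

Lemma le_refl x : x <= x.
Proof. right; reflexivity. Qed.

Lemma le_0_l x : 0 <= x.
Proof. apply le_iff; exists x; ring. Qed.

Lemma not_lt_0 x : ~ x < 0.
Proof. apply (ax_lt0 M HB). Qed.

Lemma lt_trans x y z : x < y -> y < z -> x < z.
Proof.
  rewrite !lt_iff; intros [u ->] [v ->]. exists (u + 1 + v); ring.
Qed.

Lemma lt_le_trans x y z : x < y -> y <= z -> x < z.
Proof. intros H [H'| <-]; [eapply lt_trans|]; eassumption. Qed.

Lemma le_lt_trans x y z : x <= y -> y < z -> x < z.
Proof. intros [H| ->] H'; [eapply lt_trans|]; eassumption. Qed.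

Lemma le_trans x y z : x <= y -> y <= z -> x <= z.
Proof. rewrite !le_iff; intros [u ->] [v ->]. exists (u + v); ring. Qed.

Lemma lt_0_succ x : 0 < x + 1.
Proof. apply lt_succ, le_0_l. Qed.

Lemma succ_le x y : x + 1 <= y <-> x < y.
Proof.
  rewrite le_iff, lt_iff; split; intros [z ->]; exists z; ring.
Qed.

Lemma lt_or_ge x y : x < y \/ y <= x.
Proof.
  revert x; apply (induction (fun x => x < y \/ y <= x)).
  - apply sigma1_delta0; delta0.
  - destruct (num_cases y) as [->|[z ->]]; [right; apply le_refl|left; apply lt_0_succ].
  - intros x [H|[H| ->]].
    + apply succ_le in H as [H| ->]; [left; assumption|right; apply le_refl].
    + right; left. apply lt_succ; left; assumption.
    + right; left. apply lt_succ, le_refl.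
Qed.

Lemma lt_neq_0 x : 0 < x <-> x <> 0.
Proof.
  split; [intros H ->; apply (lt_irrefl _ H)|].
  destruct (num_cases x) as [->|[y ->]]; [tauto|intros _; apply lt_0_succ].
Qed.

Lemma le_add_l x y : x <= x + y.
Proof. apply le_iff; eauto. Qed.

Lemma le_add_r x y : y <= x + y.
Proof. rewrite add_comm; apply le_add_l. Qed.

Lemma add_le_mono a b c d : a <= b -> c <= d -> a + c <= b + d.
Proof. rewrite !le_iff; intros [u ->] [v ->]. exists (u + v); ring. Qed.

Lemma mul_le_mono a b c d : a <= b -> c <= d -> a * c <= b * d.
Proof.
  rewrite !le_iff; intros [u ->] [v ->]. exists (a * v + u * c + u * v); ring.
Qed.

Lemma add_lt_mono_l a b c : b < c -> a + b < a + c.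
Proof. rewrite !lt_iff; intros [u ->]. exists u; ring. Qed.

(** Without a least element, induction on [n] shows that [P] fails everywhere below [n]. *)
Lemma least_number (P : num M -> Prop) :
  delta0 (fun e => P (e 0%nat)) -> (exists n, P n) ->
  exists n, P n /\ forall k, k < n -> ~ P k.
Proof.
  intros HP [n Hn]. apply NNPP; intros H.
  assert (H' : forall n k, k < n -> ~ P k).
  { apply (induction (fun n => forall k, k < n -> ~ P k)).
    - apply sigma1_delta0; delta0. exact (delta0_subst _ HP (fun e => e) tm_var).
    - intros k Hk; destruct (not_lt_0 _ Hk).
    - intros m IH k Hk. apply lt_succ in Hk as [Hk| ->]; [auto|].
      intros Hm; apply H; eauto. }
  apply (H' (n + 1) n); [apply lt_succ, le_refl|assumption].
Qed.

(** * Closure properties of the arithmetical classes *)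

Lemma sigma1_subst P (g : env -> env) : sigma1 P ->
  (forall i, tm (fun e => g e i)) -> sigma1 (fun e => P (g e)).
Proof.
  intros (Q & HQ & H) Hg.
  exists (fun e => Q (e 0%nat .: g (fun i => e (S i)))); split.
  - apply (delta0_subst Q HQ (fun e => e 0%nat .: g (fun i => e (S i)))).
    intros [|n]; simpl; [apply tm_var|]. apply (tm_shift (fun e => g e n)), Hg.
  - intros e; apply H.
Qed.

(** The two unbounded witnesses are replaced by a single common bound, which avoids coding pairs. *)
Lemma sigma1_and P Q : sigma1 P -> sigma1 Q -> sigma1 (fun e => P e /\ Q e).
Proof.
  intros (P' & HP & EP) (Q' & HQ & EQ).
  exists (fun e => (exists a, a < e 0%nat /\ P' (a .: fun i => e (S i)))
                /\ (exists a, a < e 0%nat /\ Q' (a .: fun i => e (S i)))); split.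
  - delta0.
    + apply (delta0_subst P' HP (fun e => e 0%nat .: fun i => e (S (S i)))).
      intros [|n]; apply tm_var.
    + apply (delta0_subst Q' HQ (fun e => e 0%nat .: fun i => e (S (S i)))).
      intros [|n]; apply tm_var.
  - intros e; rewrite EP, EQ; split.
    + intros [[a Ha] [b Hb]]; exists (a + b + 1); simpl; split; [exists a|exists b];
        (split; [apply lt_succ|assumption]); [apply le_add_l|apply le_add_r].
    + intros (c & (a & _ & Ha) & (b & _ & Hb)); eauto.
Qed.

Lemma sigma1_or P Q : sigma1 P -> sigma1 Q -> sigma1 (fun e => P e \/ Q e).
Proof.
  intros (P' & HP & EP) (Q' & HQ & EQ).
  exists (fun e => P' e \/ Q' e); split.
  - apply delta0_or; assumption.
  - intros e; rewrite EP, EQ; firstorder.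
Qed.

Lemma sigma1_ex (P : num M -> env -> Prop) :
  sigma1 (fun e => P (e 0%nat) (fun i => e (S i))) ->
  sigma1 (fun e => exists x, P x e).
Proof.
  intros (Q & HQ & E).
  exists (fun e => exists x, x < e 0%nat /\ exists a, a < e 0%nat /\
            Q (a .: x .: fun i => e (S i))); split.
  - delta0. apply (delta0_subst Q HQ (fun e => e 0%nat .: e 1%nat .: fun i => e (S (S (S i))))).
    intros [|[|n]]; apply tm_var.
  - intros e; split.
    + intros [x Hx]. apply (E (x .: e)) in Hx as [a Ha].
      exists (x + a + 1), x; simpl; split; [apply lt_succ, le_add_l|].
      exists a; split; [apply lt_succ, le_add_r|assumption].
    + intros (c & x & _ & a & _ & H). exists x; apply (E (x .: e)); eauto.
Qed.

Lemma sigma1_bounding (P : num M -> num M -> Prop) n :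
  sigma1 (fun e => P (e 0%nat) (e 1%nat)) ->
  (forall x, x < n -> exists a, P a x) ->
  exists c, forall x, x < n -> exists a, a < c /\ P a x.
Proof.
  intros (Q & HQ & E) H.
  assert (E' : forall a x, P a x <-> exists b, Q (b .: a .: x .: e0)).
  { intros a x; apply (E (a .: x .: e0)). }
  (* The inner witness [b] is bounded together with [a]; this makes the predicate for the induction
     on [k] $\Sigma^0_1$. *)
  assert (H' : exists c, forall x, x < n -> exists a, a < c /\ exists b, b < c /\
    Q (b .: a .: x .: e0)).
  { cut (forall k, k <= n -> exists c, forall x, x < k -> exists a, a < c /\
      exists b, b < c /\ Q (b .: a .: x .: e0)); [intros H'; apply H', le_refl|].
    apply (induction (fun k => k <= n -> exists c, forall x, x < k -> exists a, a < c /\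
      exists b, b < c /\ Q (b .: a .: x .: e0))).
    - apply (sigma1_iff (fun e => exists c, e 0%nat <= n -> forall x, x < e 0%nat ->
        exists a, a < c /\ exists b, b < c /\ Q (b .: a .: x .: e0))).
      + intros e; split; [intros [c H'] H''; eauto|].
        intros H'. destruct (classic (e 0%nat <= n)) as [Hn|Hn].
        * destruct (H' Hn) as [c Hc]; eauto.
        * exists 0; tauto.
      + apply sigma1_ex_delta0; delta0.
        apply (delta0_subst Q HQ (fun e => e 0%nat .: e 1%nat .: e 2%nat .: e0)).
        intros [|[|[|k]]]; [apply tm_var ..|simpl; apply tm_const].
    - intros _; exists 0; intros x Hx; destruct (not_lt_0 _ Hx).
    - intros k IH Hk. apply succ_le in Hk.
      destruct (IH (or_introl Hk)) as [c Hc], (H _ Hk) as [a Ha].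
      apply E' in Ha as [b Hb].
      exists (c + (a + b + 1)); intros x Hx. apply lt_succ in Hx as [Hx| ->].
      + destruct (Hc x Hx) as (a' & Ha' & b' & Hb' & Hab).
        exists a'; split; [eapply lt_le_trans; [eassumption|apply le_add_l]|].
        exists b'; split; [eapply lt_le_trans; [eassumption|apply le_add_l]|assumption].
      + exists a; split; [eapply lt_le_trans; [apply lt_succ, le_add_l|apply le_add_r]|].
        exists b; split; [eapply lt_le_trans; [apply lt_succ, le_add_r|apply le_add_r]|].
        assumption. }
  destruct H' as [c Hc]. exists c; intros x Hx.
  destruct (Hc x Hx) as (a & Ha & b & _ & Hb).
  exists a; split; [assumption|]. apply E'; eauto.
Qed.

Lemma sigma1_all_lt f (P : num M -> env -> Prop) :
  (* The witnesses for all [x < f e] are collected below one number by $\Sigma^0_1$ bounding. *)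
  tm f -> sigma1 (fun e => P (e 0%nat) (fun i => e (S i))) ->
  sigma1 (fun e => forall x, x < f e -> P x e).
Proof.
  intros Hf (Q & HQ & E).
  exists (fun e => forall x, x < f (fun i => e (S i)) -> exists a, a < e 0%nat /\
            Q (a .: x .: fun i => e (S i))); split.
  - apply (delta0_all_lt (fun e => f (fun i => e (S i)))
      (fun x e => exists a, a < e 0%nat /\ Q (a .: x .: fun i => e (S i)))).
    + apply tm_shift, Hf.
    + delta0. apply (delta0_subst Q HQ (fun e => e 0%nat .: e 1%nat .: fun i => e (S (S (S i))))).
      intros [|[|n]]; apply tm_var.
  - intros e; split.
    + intros H.
      apply (sigma1_bounding (fun a x => Q (a .: x .: e)) (f e)).
      * apply sigma1_delta0, (delta0_subst Q HQ (fun e' => e' 0%nat .: e' 1%nat .: e)).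
        intros [|[|n]]; [apply tm_var ..|simpl; apply tm_const].
      * intros x Hx. apply (E (x .: e)), H, Hx.
    + intros [c H] x Hx. apply (E (x .: e)).
      destruct (H x Hx) as (a & _ & Ha); eauto.
Qed.

(** * $\Delta^0_1$ predicates and comprehension *)

Definition delta1 (P : env -> Prop) : Prop := sigma1 P /\ sigma1 (fun e => ~ P e).

Lemma delta1_iff P Q : (forall e, P e <-> Q e) -> delta1 P -> delta1 Q.
Proof.
  intros H [HP HP']; split; [apply (sigma1_iff P)|apply (sigma1_iff (fun e => ~ P e))];
    trivial. intros e; rewrite H; tauto.
Qed.

Lemma delta1_delta0 P : delta0 P -> delta1 P.
Proof. split; apply sigma1_delta0; [|apply delta0_not]; assumption. Qed.

Lemma delta1_subst P (g : env -> env) : delta1 P ->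
  (forall i, tm (fun e => g e i)) -> delta1 (fun e => P (g e)).
Proof.
  intros [HP HP'] Hg; split; [apply sigma1_subst|apply (sigma1_subst (fun e => ~ P e))];
    assumption.
Qed.

Lemma delta1_not P : delta1 P -> delta1 (fun e => ~ P e).
Proof.
  intros [HP HP']; split; [assumption|]. apply (sigma1_iff P); [|assumption].
  intros e; tauto.
Qed.

Lemma delta1_and P Q : delta1 P -> delta1 Q -> delta1 (fun e => P e /\ Q e).
Proof.
  intros [HP HP'] [HQ HQ']; split; [apply sigma1_and; assumption|].
  apply (sigma1_iff (fun e => ~ P e \/ ~ Q e)); [intros e; tauto|].
  apply sigma1_or; assumption.
Qed.

Lemma delta1_or P Q : delta1 P -> delta1 Q -> delta1 (fun e => P e \/ Q e).
Proof.
  intros HP HQ. apply (delta1_iff (fun e => ~ (~ P e /\ ~ Q e))); [intros e; tauto|].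
  apply delta1_not, delta1_and; apply delta1_not; assumption.
Qed.

Lemma delta1_imp P Q : delta1 P -> delta1 Q -> delta1 (fun e => P e -> Q e).
Proof.
  intros HP HQ. apply (delta1_iff (fun e => ~ P e \/ Q e)); [intros e; tauto|].
  apply delta1_or; [apply delta1_not|]; assumption.
Qed.

Lemma delta1_all_lt f (P : num M -> env -> Prop) :
  tm f -> delta1 (fun e => P (e 0%nat) (fun i => e (S i))) ->
  delta1 (fun e => forall x, x < f e -> P x e).
Proof.
  intros Hf [HP HP']; split; [apply sigma1_all_lt; assumption|].
  apply (sigma1_iff (fun e => exists x, x < f e /\ ~ P x e)).
  - intros e; split; [intros (x & Hx & H) H'; auto|].
    intros H; apply NNPP; intros H'; apply H; intros x Hx.
    apply NNPP; intros H''; eauto.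
  - apply sigma1_ex, sigma1_and; [|assumption].
    apply sigma1_delta0, (delta0_lt (fun e => e 0%nat) (fun e => f (fun i => e (S i))));
      [apply tm_var|apply tm_shift, Hf].
Qed.

Lemma delta1_ex_lt f (P : num M -> env -> Prop) :
  tm f -> delta1 (fun e => P (e 0%nat) (fun i => e (S i))) ->
  delta1 (fun e => exists x, x < f e /\ P x e).
Proof.
  intros Hf HP. apply (delta1_iff (fun e => ~ (forall x, x < f e -> ~ P x e))).
  - intros e; split; [|intros (x & Hx & H) H'; apply (H' x Hx H)].
    intros H; apply NNPP; intros H'; apply H; intros x Hx H''; eauto.
  - apply delta1_not, delta1_all_lt, delta1_not; assumption.
Qed.

Lemma comprehension (P : num M -> Prop) :
  delta1 (fun e => P (e 0%nat)) -> exists X : sets M, forall n, mem n X <-> P n.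
Proof.
  intros [(Q & HQ & E) (R & HR & F)].
  destruct (delta0_sat Q (fun e => ~ R e) HQ (delta0_not R HR))
    as (A & B & sigma & rho & HAB).
  assert (E' : forall n, P n <-> exists a, sat sigma (a .: n .: rho) A).
  { intros n. rewrite (E (n .: e0)).
    split; intros [a Ha]; exists a; apply (proj1 (HAB a n)), Ha. }
  destruct (RCA0_comprehension M HM A B sigma rho) as [X HX].
  - intros n. rewrite <- E'. specialize (F (n .: e0)); simpl in F. split.
    + intros Hn a. apply (proj2 (HAB a n)); intros Ha. apply F; eauto.
    + intros H; apply NNPP; intros Hn. apply F in Hn as [a Ha].
      exact (proj1 (proj2 (HAB a n)) (H a) Ha).
  - exists X; intros n. rewrite HX. symmetry; apply E'.
Qed.


Lemma delta0_2 (R : num M -> num M -> Prop) (f g : env -> num M) :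
  delta0 (fun e => R (e 0%nat) (e 1%nat)) -> tm f -> tm g ->
  delta0 (fun e => R (f e) (g e)).
Proof.
  intros H Hf Hg. apply (delta0_subst _ H (fun e => f e .: g e .: e)).
  intros [|[|i]]; [assumption ..|apply tm_var].
Qed.

Lemma delta0_1 (R : num M -> Prop) f :
  delta0 (fun e => R (e 0%nat)) -> tm f -> delta0 (fun e => R (f e)).
Proof.
  intros H Hf. apply (delta0_2 (fun x _ => R x) f f); assumption.
Qed.

Lemma delta1_2 (R : num M -> num M -> Prop) (f g : env -> num M) :
  delta1 (fun e => R (e 0%nat) (e 1%nat)) -> tm f -> tm g ->
  delta1 (fun e => R (f e) (g e)).
Proof.
  intros H Hf Hg. apply (delta1_subst _ (fun e => f e .: g e .: e) H).
  intros [|[|i]]; [assumption ..|apply tm_var].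
Qed.

(** * Pairs and divisibility *)

Implicit Types (i j l p q t : num M).

Lemma le_square x : x <= x * x.
Proof.
  destruct (num_cases x) as [->|[y ->]]; [apply le_0_l|].
  apply le_iff; exists (y * y + y); ring.
Qed.

Lemma le_pair_sum i j : i + j <= pair i j.
Proof. eapply le_trans; [apply le_square|apply le_add_l]. Qed.

Lemma le_pair_l i j : i <= pair i j.
Proof. eapply le_trans; [apply le_add_l|apply le_pair_sum]. Qed.

Lemma le_pair_r i j : j <= pair i j.
Proof. eapply le_trans; [apply le_add_r|apply le_pair_sum]. Qed.

Lemma pair_le_mono i j k m : i <= k -> j <= m -> pair i j <= pair k m.
Proof.
  intros Hi Hj. apply add_le_mono; [apply mul_le_mono; apply add_le_mono|]; assumption.
Qed.

Lemma pair_lt_l i k a : i < k -> pair i a < pair k a.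
Proof.
  intros H. eapply le_lt_trans; [|apply add_lt_mono_l, H].
  apply add_le_mono; [|apply le_refl].
  apply mul_le_mono; apply add_le_mono; solve [left; assumption|apply le_refl].
Qed.

(** [pair i j] is at least $(i+j)^2$ and less than $(i+j+1)^2$, so it determines [i + j], and then
    [i]. *)
Lemma pair_inj i j k m : pair i j = pair k m -> i = k /\ j = m.
Proof.
  assert (W : forall i j k m, pair i j = pair k m -> ~ i + j < k + m).
  { clear i j k m; intros i j k m H H'. apply lt_iff in H' as [z Hz]. unfold pair in H.
    rewrite Hz in H.
    (* This number plus 1 is the difference of the two sides of [H], arranged so that no subtraction
       occurs. *)
    apply (succ_neq_0 ((i + j) * (z + z + 1) + j + z + z * (z + 1) + k)).
    symmetry; apply (add_cancel_l ((i + j) * (i + j) + i)).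
    rewrite add_0; etransitivity; [exact H|ring]. }
  intros H.
  assert (E : i + j = k + m).
  { destruct (lt_or_ge (i + j) (k + m)) as [H'|[H'|H']];
      [destruct (W _ _ _ _ H H')|destruct (W _ _ _ _ (eq_sym H) H')|auto]. }
  unfold pair in H; rewrite E in H. apply add_cancel_l in H as ->.
  split; [reflexivity|]. apply (add_cancel_l _ _ _ E).
Qed.

Lemma divides_bounded d n : divides d n <-> exists q, q < n + 1 /\ n = d * q.
Proof.
  split; [|intros (q & _ & H); exists q; assumption].
  intros [q ->]. destruct (num_cases d) as [->|[e ->]].
  (* For [d = 0] the given quotient may be too large, but the product is 0 and the quotient 0 serves
     as well. *)
  - exists 0; split; [apply lt_0_succ|ring].
  - exists q; split; [|reflexivity]. apply lt_succ, le_iff. exists (e * q); ring.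
Qed.

Lemma delta0_divides (f g : env -> num M) :
  tm f -> tm g -> delta0 (fun e => divides (f e) (g e)).
Proof.
  apply delta0_2.
  apply (delta0_iff (fun e => exists q, q < e 1%nat + 1 /\ e 1%nat = e 0%nat * q));
    [intros e; symmetry; apply divides_bounded|delta0].
Qed.

Lemma divides_mul_r d a b : divides d a -> divides d (a * b).
Proof. intros [q ->]. exists (q * b); ring. Qed.

Lemma divides_add_cancel p a b : 0 < p -> divides p a -> divides p (a + b) -> divides p b.
Proof.
  intros Hp [t ->] [s Hs].
  destruct (num_cases p) as [->|[u ->]]; [destruct (lt_irrefl _ Hp)|].
  destruct (lt_or_ge s t) as [H|H].
  - apply lt_iff in H as [z ->]. exfalso.
    apply (succ_neq_0 (u * z + u + z + b)), (add_cancel_l ((u + 1) * s)).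
    rewrite add_0; etransitivity; [|exact Hs]; ring.
  - apply le_iff in H as [z ->]. exists z.
    apply (add_cancel_l ((u + 1) * t)). rewrite Hs; ring.
Qed.

(** The modulus is coprime to [m]: its multiple [(m * (i + 1) + 1) * x] exceeds [m * x * (i + 1)] by
    exactly [x]. *)
Lemma divides_progression m i x :
  divides (m * (i + 1) + 1) (m * x) -> divides (m * (i + 1) + 1) x.
Proof.
  intros H. apply (divides_add_cancel _ (m * x * (i + 1))).
  - apply lt_0_succ.
  - apply divides_mul_r, H.
  - exists x; ring.
Qed.

(* The two moduli differ by [m * |i - j|], and [|i - j|] divides [m]. *)
Lemma divides_progression_mul m i j k q :
  (forall l, l < k -> divides (l + 1) m) -> i < k -> j < k -> i <> j ->
  divides (m * (i + 1) + 1) ((m * (j + 1) + 1) * q) ->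
  divides (m * (i + 1) + 1) q.
Proof.
  intros Hm Hi Hj Hij H.
  assert (H' : exists d, d < k /\ divides (m * (i + 1) + 1) (m * ((d + 1) * q))).
  { destruct (lt_or_ge i j) as [L|[L|L]]; [| |congruence];
      apply lt_iff in L as [d ->]; exists d; split.
    - apply (le_lt_trans _ _ _ (le_trans _ _ _ (le_add_r i d) (le_add_l _ 1)) Hj).
    - apply (divides_add_cancel _ ((m * (i + 1) + 1) * q)); [apply lt_0_succ|exists q; ring|].
      destruct H as [s Hs]; exists s. rewrite <- Hs; ring.
    - apply (le_lt_trans _ _ _ (le_trans _ _ _ (le_add_r j d) (le_add_l _ 1)) Hi).
    - apply (divides_add_cancel _ ((m * (j + 1) + 1) * q)); [apply lt_0_succ|assumption|].
      exists q; ring. }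
  destruct H' as (d & Hd & H'). apply divides_progression in H'.
  destruct (Hm d Hd) as [m' Hm'].
  (* Here [d + 1] is the distance of [i] and [j]. As it divides [m], one can pass from [(d + 1) * q]
     to its multiple [m * q] and cancel [m] again. *)
  apply divides_progression.
  destruct H' as [s Hs]. exists (m' * s).
  transitivity (m' * ((d + 1) * q)); [rewrite Hm'|rewrite Hs]; ring.
Qed.

(** * Codes of finite sets *)


Ltac delta0_atom ::= apply delta0_divides; [solve [tm]|solve [tm]].

Lemma triple_bounded c (P : num M -> num M -> num M -> Prop) :
  (exists k m n, c = pair (pair k m) n /\ P k m n) <->
  exists k, k < c + 1 /\ exists m, m < c + 1 /\ exists n, n < c + 1 /\
    c = pair (pair k m) n /\ P k m n.
Proof.
  split; [|intros (k & _ & m & _ & n & _ & H); eauto].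
  intros (k & m & n & -> & H).
  exists k; split; [|exists m; split; [|exists n; split; [|auto]]]; apply lt_succ.
  - eapply le_trans; apply le_pair_l.
  - eapply le_trans; [apply le_pair_r|apply le_pair_l].
  - apply le_pair_r.
Qed.

Lemma delta0_triple (P : num M -> num M -> num M -> env -> Prop) f :
  tm f -> delta0 (fun e => P (e 2%nat) (e 1%nat) (e 0%nat) (fun u => e (S (S (S u))))) ->
  delta0 (fun e => exists k m n, f e = pair (pair k m) n /\ P k m n e).
Proof.
  intros Hf HP.
  apply (delta0_iff (fun e => exists k, k < f e + 1 /\ exists m, m < f e + 1 /\
    exists n, n < f e + 1 /\ f e = pair (pair k m) n /\ P k m n e)).
  { intros e; symmetry; apply triple_bounded. }
  pose proof (tm_shift f Hf) as Hf1.
  pose proof (tm_shift _ Hf1) as Hf2. pose proof (tm_shift _ Hf2) as Hf3.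
  apply (delta0_ex_lt (fun e => f e + 1)); [tm; assumption|].
  apply (delta0_ex_lt (fun e => f (fun u => e (S u)) + 1)); [tm; assumption|].
  apply (delta0_ex_lt (fun e => f (fun u => e (S (S u))) + 1)); [tm; assumption|].
  apply delta0_and; [|assumption].
  apply (delta0_eq (fun e => f (fun u => e (S (S (S u)))))); [assumption|tm].
Qed.

Lemma delta0_fin_mem (f g : env -> num M) :
  tm f -> tm g -> delta0 (fun e => fin_mem (f e) (g e)).
Proof.
  apply delta0_2. apply delta0_triple; [tm|delta0].
Qed.

Lemma delta0_is_triple f : tm f -> delta0 (fun e => is_triple (f e)).
Proof.
  apply delta0_1.
  apply (delta0_iff (fun e => exists k m n, e 0%nat = pair (pair k m) n /\ True)).
  { intros e; unfold is_triple; firstorder. }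
  apply delta0_triple; [tm|delta0].
Qed.

Ltac delta0_atom ::= first [ apply delta0_divides; [solve [tm]|solve [tm]]
  | apply delta0_fin_mem; [solve [tm]|solve [tm]]
  | apply delta0_is_triple; solve [tm] ].

Lemma fin_mem_triple i k m n :
  fin_mem i (pair (pair k m) n) <-> i < k /\ divides (m * (i + 1) + 1) n.
Proof.
  split; [|intros H; exists k, m, n; auto].
  intros (k' & m' & n' & E & H).
  apply pair_inj in E as [E ->]. apply pair_inj in E as [-> ->]. assumption.
Qed.

Lemma fin_mem_lt i c : fin_mem i c -> i < c.
Proof.
  intros (k & m & n & -> & H & _). eapply lt_le_trans; [eassumption|].
  eapply le_trans; apply le_pair_l.
Qed.

(* The moduli [m * (i + 1) + 1], [i < k], are pairwise coprime and [n] is a common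
   multiple, so every subset of [{0, ..., k - 1}] has a code [<= B].  Such a [B] turns
   quantifiers over finite subsets into bounded ones. *)
Definition is_bound k B : Prop := exists m n, B = pair (pair k m) n /\
  0 < m /\ (forall i, i < k -> divides (i + 1) m) /\
  0 < n /\ (forall i, i < k -> divides (m * (i + 1) + 1) n).

(** The induction multiplies by one more factor [f k + 1] at each step; asking only for a positive
    common multiple avoids defining the product. *)
Lemma common_multiple (f : num M -> num M) k :
  tm (fun e => f (e 0%nat)) ->
  exists n, 0 < n /\ forall i, i < k -> divides (f i + 1) n.
Proof.
  intros Hf. revert k.
  apply (induction (fun k => exists n, 0 < n /\ forall i, i < k -> divides (f i + 1) n)).
  - apply sigma1_ex_delta0; delta0. apply delta0_divides; tm.
    apply (tm_subst _ (fun e _ => e 0%nat) Hf). intros _; apply tm_var.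
  - exists 1; split; [rewrite <- (add_0_l 1); apply lt_0_succ|].
    intros i Hi; destruct (not_lt_0 _ Hi).
  - intros k (n & Hn & H). exists (n * (f k + 1)); split.
    + apply lt_iff in Hn as [z ->]. apply lt_iff. exists (z * f k + z + f k); ring.
    + intros i Hi. apply lt_succ in Hi as [Hi| ->]; [apply divides_mul_r; auto|].
      exists n; ring.
Qed.

Lemma is_bound_ex k : exists B, is_bound k B.
Proof.
  destruct (common_multiple (fun i => i) k) as (m & Hm & H); [tm|].
  destruct (common_multiple (fun i => m * (i + 1)) k) as (n & Hn & H'); [tm|].
  exists (pair (pair k m) n), m, n; auto.
Qed.

Lemma delta0_is_bound (f g : env -> num M) :
  tm f -> tm g -> delta0 (fun e => is_bound (f e) (g e)).
Proof.
  apply delta0_2.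
  apply (delta0_iff (fun e => exists k m n, e 1%nat = pair (pair k m) n /\
    (k = e 0%nat /\ 0 < m /\ (forall i, i < k -> divides (i + 1) m) /\
     0 < n /\ (forall i, i < k -> divides (m * (i + 1) + 1) n)))).
  - intros e; split.
    + intros (k & m & n & H & <- & H'). exists m, n; auto.
    + intros (m & n & H). exists (e 0%nat), m, n; tauto.
  - apply delta0_triple; [tm|delta0].
Qed.

(** Take the least positive common multiple [n] of the moduli with index in [P]. If the modulus of
    some [i < k] outside [P] divided [n], the quotient would, by coprimality, be a smaller common
    multiple. *)
Lemma triple_ex (P : num M -> Prop) k B :
  delta0 (fun e => P (e 0%nat)) -> is_bound k B -> (forall i, P i -> i < k) ->
  exists c, c <= B /\ is_triple c /\ forall i, fin_mem i c <-> P i.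
Proof.
  intros HP (m & N & -> & Hm & Hdm & HN & HdN) Hk.
  destruct (least_number (fun n => 0 < n /\
    forall i, i < k -> P i -> divides (m * (i + 1) + 1) n)) as (n & [Hn Hdn] & Hmin).
  - delta0. apply (delta0_1 P); [assumption|tm].
  - exists N; auto.
  - exists (pair (pair k m) n).
    assert (HnN : n <= N).
    { destruct (lt_or_ge N n) as [H|H]; [|assumption].
      destruct (Hmin N H); auto. }
    split; [apply pair_le_mono; [apply le_refl|assumption]|].
    split; [exists k, m, n; reflexivity|].
    intros i; rewrite fin_mem_triple; split; [|auto].
    intros [Hi [q Hq]]. apply NNPP; intros Hni.
    assert (Hq0 : 0 < q).
    { apply lt_neq_0; intros ->. apply (lt_irrefl 0). rewrite Hq, mul_0 in Hn; assumption. }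
    apply (Hmin q); [|split; [assumption|]].
    + rewrite Hq. apply lt_iff in Hm as [u ->]. apply lt_iff in Hq0 as [v ->].
      apply lt_iff. exists ((u * (i + 1) + i) * (v + 1) + v); ring.
    + intros j Hj HPj. apply (divides_progression_mul m j i k); auto.
      * intros ->; auto.
      * rewrite <- Hq; auto.
Qed.

(** Comprehension turns [P] into a set, which may occur in $\Delta^0_0$ predicates; the least number
    principle then picks the least description. *)
Lemma code_ex_bounded (P : num M -> Prop) k B :
  delta1 (fun e => P (e 0%nat)) -> is_bound k B -> (forall i, P i -> i < k) ->
  exists c, codes c P /\ c <= B.
Proof.
  intros HP HB' Hk. destruct (comprehension P HP) as [X HX].
  destruct (triple_ex (fun i => mem i X) k B) as (c0 & Hc0 & H); trivial.
  { delta0. }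
  { intros i; rewrite HX; apply Hk. }
  destruct (least_number (fun c => is_triple c /\ (forall i, i < c -> fin_mem i c -> mem i X) /\
    (forall i, i < k -> mem i X -> fin_mem i c))) as (c & (Hc & Hc' & Hc'') & Hmin).
  - delta0.
  - exists c0; repeat split; try apply H; intros i _; apply H.
  - assert (E : forall i, fin_mem i c <-> P i).
    { intros i; rewrite <- HX; split; intros Hi; [apply Hc'; [apply fin_mem_lt|]|apply Hc''];
        trivial. apply Hk, HX, Hi. }
    exists c; split; [split; [split; [assumption|]|assumption]|].
    + intros d Hd Hdt Hsame. apply (Hmin d Hd). split; [assumption|].
      split; intros i _; rewrite Hsame, E, HX; trivial.
    + destruct (lt_or_ge c0 c) as [L|L]; [|eapply le_trans; eassumption].
      destruct (Hmin c0 L). split; [tauto|]. split; intros i _; apply H.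
Qed.

Lemma code_ex (P : num M -> Prop) k :
  delta1 (fun e => P (e 0%nat)) -> (forall i, P i -> i < k) -> exists c, codes c P.
Proof.
  intros HP Hk. destruct (is_bound_ex k) as [B HB'].
  destruct (code_ex_bounded P k B HP HB' Hk) as (c & Hc & _); eauto.
Qed.

Lemma fincode_ext c d : fincode c -> fincode d ->
  (forall i, fin_mem i c <-> fin_mem i d) -> c = d.
Proof.
  intros [Hc Hc'] [Hd Hd'] H. destruct (lt_or_ge c d) as [L|[L|L]]; [| |auto].
  - destruct (Hd' c L Hc H).
  - destruct (Hc' d L Hd). intros i; symmetry; apply H.
Qed.

Lemma fincode_bounded c k B :
  fincode c -> is_bound k B -> (forall i, fin_mem i c -> i < k) -> c <= B.
Proof.
  intros Hc HB' Hk. destruct (code_ex_bounded (fun i => fin_mem i c) k B) as (d & [Hd E] & Hle);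
    trivial.
  - apply delta1_delta0; delta0.
  - rewrite (fincode_ext c d); trivial. intros i; symmetry; apply E.
Qed.


Lemma delta0_fincode f : tm f -> delta0 (fun e => fincode (f e)).
Proof.
  apply delta0_1.
  apply (delta0_iff (fun e => is_triple (e 0%nat) /\ forall d, d < e 0%nat -> is_triple d ->
    ~ (forall i, i < e 0%nat -> (fin_mem i d <-> fin_mem i (e 0%nat))))); [|delta0].
  intros e; split; intros [Ht H]; (split; [assumption|]); intros d Hd Hdt Hsame.
  - apply (H d Hd Hdt); auto.
  - apply (H d Hd Hdt). intros i; split; intros Hi; apply Hsame; trivial.
    + eapply lt_trans; [apply fin_mem_lt|]; eassumption.
    + apply fin_mem_lt, Hi.
Qed.

Lemma delta0_is_string (f g : env -> num M) :
  tm f -> tm g -> delta0 (fun e => is_string (f e) (g e)).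
Proof.
  apply delta0_2.
  apply (delta0_iff (fun e => fincode (e 1%nat) /\
    forall i, i < e 1%nat -> fin_mem i (e 1%nat) -> i < e 0%nat)).
  - intros e; split; intros [Hc H]; (split; [assumption|]); intros i Hi; auto using fin_mem_lt.
  - apply delta0_and; [apply delta0_fincode; tm|delta0].
Qed.

Ltac delta0_atom ::= first [ apply delta0_divides; [solve [tm]|solve [tm]]
  | apply delta0_fin_mem; [solve [tm]|solve [tm]]
  | apply delta0_is_triple; solve [tm]
  | apply delta0_is_string; [solve [tm]|solve [tm]]
  | apply delta0_is_bound; [solve [tm]|solve [tm]]].

(** Bounds exist and the choice of [B] does not matter, so both [P] and its negation can be
    expressed by an unbounded search for some [B]. This is how quantifiers over finite sets become
    $\Delta^0_1$. *)
Lemma delta1_bounded f (P : env -> Prop) (Q : num M -> env -> Prop) :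
  tm f -> delta1 (fun e => Q (e 0%nat) (fun u => e (S u))) ->
  (forall e B, is_bound (f e) B -> (P e <-> Q B e)) -> delta1 P.
Proof.
  intros Hf [HQ HQ'] H.
  assert (Hb : delta0 (fun e => is_bound (f (fun u => e (S u))) (e 0%nat))).
  { apply (delta0_is_bound (fun e => f (fun u => e (S u)))); [apply tm_shift, Hf|tm]. }
  split.
  - apply (sigma1_iff (fun e => exists B, is_bound (f e) B /\ Q B e)).
    + intros e; split; [intros (B & HB' & HQB); apply (H e B); assumption|].
      intros HP. destruct (is_bound_ex (f e)) as [B HB']. exists B; split; [assumption|].
      apply (H e B); assumption.
    + apply sigma1_ex, sigma1_and; [apply sigma1_delta0|]; assumption.
  - apply (sigma1_iff (fun e => exists B, is_bound (f e) B /\ ~ Q B e)).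
    + intros e; split; [intros (B & HB' & HQB); rewrite (H e B); assumption|].
      intros HP. destruct (is_bound_ex (f e)) as [B HB']. exists B; split; [assumption|].
      rewrite <- (H e B); assumption.
    + apply sigma1_ex, sigma1_and; [apply sigma1_delta0|]; assumption.
Qed.

Ltac delta1_step := cbv beta;
  first [ solve [apply delta1_delta0; delta0]
    | apply delta1_all_lt; [solve [tm]|] | apply delta1_ex_lt; [solve [tm]|]
    | apply delta1_not | apply delta1_and | apply delta1_or | apply delta1_imp ].
Ltac delta1 := repeat delta1_step.

(** * Covers by small sets *)

Context (HW : WKL M) (J : sets M -> Prop) (HJ : free_ideal J) (U : sets M)
  (HT : forall i, binary_tree (section U i))
  (HU : forall X, J X <-> exists i, path (section U i) X).

(* [level j F n]: the part of [F] below [n] is contained in a string of length [n]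
   of the [j]-th tree.  A set [D] codes the sequence of the sets
   [D_i = {a : pair i a in D}]; [pieces k D] says that at most the first [k] of them
   are nonempty and that, whenever [a] is in [D_i], the part of [D_i] up to [a] is at
   level [a + 1] of one of the first [k] trees. *)
Definition level j (F : num M -> Prop) n : Prop :=
  exists c, section U j (pair n c) /\ forall b, b < n -> F b -> fin_mem b c.

Definition pieces k (D : num M -> Prop) : Prop :=
  forall i a, D (pair i a) ->
    i < k /\ exists j, j < k /\ level j (fun b => D (pair i b)) (a + 1).

(** The same [k] limits the number of pieces and the indices of the trees, so that these bounds add
    up under unions. *)
Definition small k x : Prop :=
  exists d, pieces k (fun p => fin_mem p d) /\
    forall a, fin_mem a x -> exists i, i < k /\ fin_mem (pair i a) d.

Lemma tree_string j n c : section U j (pair n c) -> is_string n c.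
Proof.
  intros H. destruct (proj1 (HT j) _ H) as (l & d & E & Hs).
  apply pair_inj in E as [-> ->]. assumption.
Qed.

Lemma level_mono j (F F' : num M -> Prop) n :
  (forall b, b < n -> F' b -> F b) -> level j F n -> level j F' n.
Proof. intros H (c & Hc & H'). exists c; auto. Qed.

Lemma level_restrict j F n n' : level j F n -> n' <= n -> level j F n'.
Proof.
  intros (c & Hc & H) Hn.
  destruct (code_ex (fun i => i < n' /\ fin_mem i c) n') as [d [Hd E]].
  { apply delta1_delta0; delta0. }
  { tauto. }
  exists d; split.
  - apply (proj2 (HT j) n c); trivial.
    + split; [assumption|]. intros i Hi; apply E in Hi; tauto.
    + intros i Hi; rewrite E; tauto.
  - intros b Hb HF. apply E; split; [assumption|].
    apply H; [eapply lt_le_trans; eassumption|assumption].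
Qed.

(** The string sought has length [g e] and a canonical code, which is at most any bound for
    [g e]. *)
Lemma delta1_level (f g : env -> num M) (F : num M -> env -> Prop) :
  tm f -> tm g -> delta0 (fun e => F (e 0%nat) (fun u => e (S u))) ->
  delta1 (fun e => level (f e) (fun b => F b e) (g e)).
Proof.
  intros Hf Hg HF.
  apply (delta1_bounded g _ (fun B e => exists c, c < B + 1 /\
    section U (f e) (pair (g e) c) /\ forall b, b < g e -> F b e -> fin_mem b c)); [assumption| |].
  - pose proof (tm_shift _ (tm_shift f Hf)) as Hf2.
    pose proof (tm_shift _ (tm_shift g Hg)) as Hg2.
    apply delta1_delta0, delta0_ex_lt; [tm|]. apply delta0_and.
    + apply (delta0_mem (fun e => pair (f (fun u => e (S (S u))))
        (pair (g (fun u => e (S (S u)))) (e 0%nat)))); tm; assumption.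
    + apply (delta0_all_lt (fun e => g (fun u => e (S (S u))))
        (fun b e => F b (fun u => e (S (S u))) -> fin_mem b (e 0%nat))); [assumption|].
      apply delta0_imp; [|delta0].
      apply (delta0_subst _ HF (fun e => e 0%nat .: fun u => e (S (S (S u))))).
      intros [|u]; apply tm_var.
  - intros e B HB'; split; [|intros (c & _ & H); exists c; exact H].
    intros (c & Hc & H). exists c; split; [|auto].
    apply tree_string in Hc as [Hc Hlt]. apply lt_succ, (fincode_bounded c (g e)); assumption.
Qed.

Lemma delta1_pieces (f h : env -> num M) :
  tm f -> tm h -> delta1 (fun e => pieces (f e) (fun p => fin_mem p (h e))).
Proof.
  apply (delta1_2 (fun k d => pieces k (fun p => fin_mem p d))).
  apply (delta1_iff (fun e => forall i, i < e 1%nat -> forall a, a < e 1%nat ->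
    fin_mem (pair i a) (e 1%nat) ->
    i < e 0%nat /\ exists j, j < e 0%nat /\
      level j (fun b => fin_mem (pair i b) (e 1%nat)) (a + 1))).
  - intros e; split; intros H; [intros i a Hp|intros i _ a _; apply H].
    pose proof (fin_mem_lt _ _ Hp) as Hlt.
    apply H; trivial; eapply le_lt_trans; try eassumption; [apply le_pair_l|apply le_pair_r].
  - delta1. apply (delta1_level (fun e => e 0%nat) (fun e => e 1%nat + 1)
      (fun b e => fin_mem (pair (e 2%nat) b) (e 4%nat))); [tm|tm|delta0].
Qed.

Lemma pieces_subset k (D D' : num M -> Prop) :
  (forall p, D' p -> D p) -> pieces k D -> pieces k D'.
Proof.
  intros H HD i a Hia. destruct (HD i a (H _ Hia)) as (Hi & j & Hj & Hl).
  split; [assumption|]. exists j; split; [assumption|]. revert Hl; apply level_mono; auto.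
Qed.

(** Covering [x] uses only pairs [pair i a] with [i < k] and [a < x]. Since pieces pass to subsets,
    the cover can be cut off at [pair k x], and its code is then bounded. *)
Lemma delta1_small : delta1 (fun e => small (e 0%nat) (e 1%nat)).
Proof.
  apply (delta1_bounded (fun e => pair (e 0%nat) (e 1%nat)) _ (fun B e => exists d, d < B + 1 /\
    pieces (e 0%nat) (fun p => fin_mem p d) /\
    forall a, a < e 1%nat -> fin_mem a (e 1%nat) ->
      exists i, i < e 0%nat /\ fin_mem (pair i a) d)); [tm| |].
  - delta1. apply (delta1_pieces (fun e => e 2%nat) (fun e => e 0%nat)); tm.
  - intros e B HB'; split; intros (d & Hd).
    + destruct Hd as [Hd Hx].
      destruct (code_ex_bounded (fun p => p < pair (e 0%nat) (e 1%nat) /\ fin_mem p d)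
        (pair (e 0%nat) (e 1%nat)) B) as (d' & [_ E] & Hle).
      { apply delta1_delta0; delta0. }
      { assumption. }
      { tauto. }
      exists d'; split; [apply lt_succ, Hle|]. split.
      * revert Hd; apply pieces_subset. intros p Hp; apply E in Hp; tauto.
      * intros a Ha Hax. destruct (Hx a Hax) as (i & Hi & Hia).
        exists i; split; [assumption|]. apply E; split; [|assumption].
        eapply lt_le_trans; [apply pair_lt_l, Hi|].
        apply pair_le_mono; [apply le_refl|left; assumption].
    + destruct Hd as (_ & Hd & Hx). exists d; split; [assumption|].
      intros a Ha. apply Hx; [apply fin_mem_lt|]; assumption.
Qed.

Lemma small_mono k l x y : small k x -> k <= l ->
  (forall a, fin_mem a y -> fin_mem a x) -> small l y.
Proof.
  intros (d & Hd & Hx) Hkl Hyx. exists d; split.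
  - intros i a Hia. destruct (Hd i a Hia) as (Hi & j & Hj & Hl).
    split; [eapply lt_le_trans; eassumption|].
    exists j; split; [eapply lt_le_trans; eassumption|assumption].
  - intros a Ha. destruct (Hx a (Hyx a Ha)) as (i & Hi & Hia).
    exists i; split; [eapply lt_le_trans; eassumption|assumption].
Qed.

Lemma small_union k l x y z : small k x -> small l y ->
  (forall a, fin_mem a z -> fin_mem a x \/ fin_mem a y) -> small (k + l) z.
Proof.
  intros (d & Hd & Hx) (d' & Hd' & Hy) Hz.
  (* The pieces of [d'] are renumbered from [k] on. The pieces of [d] have indices below [k], so the
     two blocks do not mix. *)
  set (D := fun p => fin_mem p d \/ exists i, i < d' /\ exists a, a < d' /\
    p = pair (k + i) a /\ fin_mem (pair i a) d').
  destruct (code_ex D (d + pair (k + d') d' + 1)) as [c [_ Hc]].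
  { apply delta1_delta0; unfold D; delta0. }
  { intros p [Hp|(i & Hi & a & Ha & -> & _)]; apply lt_succ.
    - eapply le_trans; [left; apply fin_mem_lt, Hp|apply le_add_l].
    - eapply le_trans; [|apply le_add_r].
      apply pair_le_mono; [apply add_le_mono; [apply le_refl|left; assumption]|].
      left; assumption. }
  assert (HD : forall i a, fin_mem (pair i a) d' -> fin_mem (pair (k + i) a) c).
  { intros i a Hp. pose proof (fin_mem_lt _ _ Hp) as Hlt. apply Hc; right.
    exists i; split; [eapply le_lt_trans; [apply le_pair_l|eassumption]|].
    exists a; split; [eapply le_lt_trans; [apply le_pair_r|eassumption]|]. auto. }
  assert (HDk : forall i, ~ k + i < k).
  { intros i H. apply (lt_irrefl k). eapply le_lt_trans; [apply le_add_l|eassumption]. }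
  exists c; split.
  - intros i a Hp. apply Hc in Hp as [Hp|(i' & _ & a' & _ & E & Hp)].
    + destruct (Hd i a Hp) as (Hi & j & Hj & Hl).
      split; [eapply lt_le_trans; [eassumption|apply le_add_l]|].
      exists j; split; [eapply lt_le_trans; [eassumption|apply le_add_l]|].
      revert Hl; apply level_mono; intros b _ Hb.
      apply Hc in Hb as [Hb|(i' & _ & b' & _ & E & _)]; [assumption|].
      apply pair_inj in E as [-> _]. destruct (HDk _ Hi).
    + apply pair_inj in E as [-> ->].
      destruct (Hd' i' a' Hp) as (Hi & j & Hj & Hl).
      split; [apply add_lt_mono_l, Hi|].
      exists j; split; [eapply lt_le_trans; [eassumption|apply le_add_r]|].
      revert Hl; apply level_mono; intros b _ Hb.
      apply Hc in Hb as [Hb|(i & _ & b' & _ & E & Hb)].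
      * apply Hd in Hb as [Hb _]. destruct (HDk _ Hb).
      * apply pair_inj in E as [E ->]. apply add_cancel_l in E as ->. assumption.
  - intros a Ha. apply Hz in Ha as [Ha|Ha].
    + destruct (Hx a Ha) as (i & Hi & Hia). exists i; split.
      * eapply lt_le_trans; [eassumption|apply le_add_l].
      * apply Hc; left; assumption.
    + destruct (Hy a Ha) as (i & Hi & Hia). exists (k + i); split.
      * apply add_lt_mono_l, Hi.
      * auto.
Qed.

(** One piece, with index 0, is enough; the bound [j + 1] admits the tree with index [j]. *)
Lemma small_path j X x : path (section U j) X ->
  (forall a, fin_mem a x -> mem a X) -> small (j + 1) x.
Proof.
  intros HX Hx.
  destruct (code_ex (fun p => exists a, a < x /\ p = pair 0 a /\ fin_mem a x) (pair 0 x + 1))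
    as [d [_ Hd]].
  { apply delta1_delta0; delta0. }
  { intros p (a & Ha & -> & _). apply lt_succ, pair_le_mono; [apply le_refl|left; assumption]. }
  exists d; split.
  - intros i a Hp. apply Hd in Hp as (a' & _ & E & Ha). apply pair_inj in E as [-> ->].
    split; [apply lt_0_succ|]. exists j; split; [apply lt_succ, le_refl|].
    destruct (HX (a' + 1)) as (c & [_ Hc] & Hs). exists c; split; [assumption|].
    intros b Hb Hp. apply Hd in Hp as (b' & _ & E & Hb').
    apply pair_inj in E as [_ ->]. apply Hc; auto.
  - intros a Ha. exists 0; split; [apply lt_0_succ|]. apply Hd.
    exists a; auto using fin_mem_lt.
Qed.

Lemma small_ex x : exists k, small k x.
Proof.
  destruct (ideal_initial J HJ x) as (X & HX & E).
  apply HU in HX as [j Hj]. exists (j + 1). apply (small_path j X); [assumption|].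
  intros a Ha. apply E. left; apply fin_mem_lt, Ha.
Qed.

(** * Recovering the ideal from the covers *)

Lemma in_ideal_of_level (X : sets M) j : (forall n, level j (fun b => mem b X) n) -> J X.
Proof.
  intros H.
  (* [T] is the subtree of those strings of the [j]-th tree that include [X] below their length. *)
  destruct (comprehension (fun s => section U j s /\ exists n, n < s + 1 /\
    exists c, c < s + 1 /\ s = pair n c /\ forall b, b < n -> mem b X -> fin_mem b c))
    as [T HTr].
  { unfold section; delta1. }
  assert (HTp : forall n c, mem (pair n c) T <->
    section U j (pair n c) /\ forall b, b < n -> mem b X -> fin_mem b c).
  { intros n c; rewrite HTr; split; intros [Hs Hc]; (split; [assumption|]).
    - destruct Hc as (n' & _ & c' & _ & E & Hc). apply pair_inj in E as [-> ->]. assumption.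
    - exists n; split; [apply lt_succ, le_pair_l|].
      exists c; split; [apply lt_succ, le_pair_r|]. auto. }
  destruct (HW T) as [Y HY].
  - split.
    + intros s Hs. apply (proj1 (HT j)), HTr, Hs.
    + intros l c k d Hc Hd Hkl Hcd. apply HTp in Hc as [Hs Hc]. apply HTp; split.
      * apply (proj2 (HT j) l c); assumption.
      * intros b Hb HX. apply Hcd; [assumption|].
        apply Hc; [eapply lt_le_trans; eassumption|assumption].
  - intros m. destruct (H (m + 1)) as (c & Hc). exists (pair (m + 1) c); split.
    + eapply lt_le_trans; [apply lt_succ, le_refl|apply le_pair_l].
    + apply HTp, Hc.
  - apply (ideal_subset J HJ X Y).
    + intros b Hb. destruct (HY (b + 1)) as (c & [_ Hc] & Hs). apply HTp in Hs as [_ Hs].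
      apply (Hc b), Hs; [apply lt_succ, le_refl|assumption].
    + apply HU. exists j. intros n. destruct (HY n) as (c & Hc & Hs).
      exists c; split; [assumption|]. apply HTp, Hs.
Qed.

Lemma piece_in_ideal m (D : sets M) i : pieces m (fun p => mem p D) ->
  in_class J (section D i).
Proof.
  intros HD. destruct (comprehension (section D i)) as [X HX].
  { unfold section; delta1. }
  exists X; split; [|assumption].
  destruct (classic (exists n, forall a, mem a X -> a <= n)) as [[n Hn]|Hinf].
  { destruct (ideal_initial J HJ n) as (Z & HZ & E).
    apply (ideal_subset J HJ X Z); [|assumption].
    intros a Ha. apply E, Hn, Ha. }
  (* The piece is now unbounded: it has an element [a > n], and the level [a + 1] restricts to
     [n]. *)
  assert (Hlev : forall n, exists j, j < m /\ level j (fun b => mem b X) n).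
  { intros n. apply NNPP; intros Hno. apply Hinf. exists n; intros a Ha.
    destruct (lt_or_ge n a) as [L|L]; [|assumption]. exfalso; apply Hno.
    apply HX in Ha. destruct (HD i a Ha) as (_ & j & Hj & Hl).
    exists j; split; [assumption|]. apply (level_restrict j _ (a + 1)).
    - revert Hl; apply level_mono. intros b _ Hb; apply HX, Hb.
    - eapply le_trans; [left; eassumption|apply le_add_l]. }
  apply NNPP; intros HnJ.
  (* If every tree failed at some level, there would be an [n] above one failure of each of the
     first [m] trees. Some tree succeeds at [n], hence also at its own smaller level of failure. *)
  destruct (sigma1_bounding (fun n j => ~ level j (fun b => mem b X) n) m) as [n Hn].
  - apply (delta1_level (fun e => e 1%nat) (fun e => e 0%nat) (fun b e => mem b X));
      [tm|tm|delta0].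
  - intros j _. apply not_all_ex_not; intros H. apply HnJ, (in_ideal_of_level X j H).
  - destruct (Hlev n) as (j & Hj & Hl). destruct (Hn j Hj) as (n' & Hn' & Hnl).
    apply Hnl. apply (level_restrict j _ n); [assumption|left; assumption].
Qed.

(** The finite covers, cut off at arbitrary lengths, form a tree, and a path through it is a cover
    of all of [X]. *)
Lemma pieces_ex m (X : sets M) :
  (forall n x, codes x (fun i => i < n /\ mem i X) -> small m x) ->
  exists D : sets M, pieces m (fun p => mem p D) /\
    forall a, mem a X -> exists i, i < m /\ mem (pair i a) D.
Proof.
  intros H.
  (* A string of length [l] must cover [a] only if [pair m a <= l], when every [pair i a] with
     [i < m] lies below [l]. This keeps the condition stable under restriction; [a < l + 1] merely
     bounds the quantifier. *)
  set (S l d := is_string l d /\ pieces m (fun p => fin_mem p d) /\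
    forall a, a < l + 1 -> mem a X -> pair m a <= l -> exists i, i < m /\ fin_mem (pair i a) d).
  destruct (comprehension (fun s => exists l, l < s + 1 /\ exists d, d < s + 1 /\
    s = pair l d /\ S l d)) as [T HTr].
  { unfold S; delta1. apply (delta1_pieces (fun _ => m) (fun e => e 0%nat)); tm. }
  assert (HTp : forall l d, mem (pair l d) T <-> S l d).
  { intros l d; rewrite HTr; split.
    - intros (l' & _ & d' & _ & E & HS). apply pair_inj in E as [-> ->]. assumption.
    - intros HS. exists l; split; [apply lt_succ, le_pair_l|].
      exists d; split; [apply lt_succ, le_pair_r|]. auto. }
  destruct (HW T) as [D HD].
  - split.
    + intros s Hs. apply HTr in Hs as (l & _ & d & _ & E & Hs & _). eauto.
    + intros l c k d Hc Hd Hkl Hcd. apply HTp in Hc as (Hs & Hc & Hcov). apply HTp.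
      split; [assumption|split].
      * revert Hc; apply pieces_subset. intros p Hp. apply Hcd; [|assumption].
        apply (proj2 Hd), Hp.
      * intros a Ha HX Hak.
        destruct (Hcov a) as (i & Hi & Hia); trivial.
        { eapply lt_le_trans; [eassumption|]. apply add_le_mono; [assumption|apply le_refl]. }
        { eapply le_trans; eassumption. }
        exists i; split; [assumption|]. apply Hcd; [|assumption].
        eapply lt_le_trans; [apply pair_lt_l, Hi|assumption].
  - intros n. set (l := n + 1).
    destruct (code_ex (fun i => i < l + 1 /\ mem i X) (l + 1)) as [x Hx].
    { delta1. }
    { tauto. }
    destruct (H _ _ Hx) as (d & Hd & Hcov).
    (* The cover is cut down to a string of length [l], whose code in the tree exceeds [n]. *)
    destruct (code_ex (fun p => p < l /\ fin_mem p d) l) as [d' [Hd' E]].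
    { delta1. }
    { tauto. }
    exists (pair l d'); split.
    { eapply lt_le_trans; [apply lt_succ, le_refl|apply le_pair_l]. }
    apply HTp. split; [split; [assumption|]|split].
    + intros i Hi. apply E, Hi.
    + revert Hd; apply pieces_subset. intros p Hp; apply E, Hp.
    + intros a Ha HX Hal. destruct (Hcov a) as (i & Hi & Hia).
      { apply Hx; auto. }
      exists i; split; [assumption|]. apply E; split; [|assumption].
      eapply lt_le_trans; [apply pair_lt_l, Hi|assumption].
  - exists D; split.
    (* Level [a + 1] of the piece concerns only pairs [pair i b] with [b <= a], all of which occur
       in the initial segment of [D] of length [pair i a + 1]. *)
    + intros i a Hia. destruct (HD (pair i a + 1)) as (c & [_ Hc] & Hs).
      apply HTp in Hs as (_ & Hp & _).
      destruct (Hp i a) as (Hi & j & Hj & Hl).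
      { apply Hc; split; [apply lt_succ, le_refl|assumption]. }
      split; [assumption|]. exists j; split; [assumption|].
      revert Hl; apply level_mono. intros b Hb Hib. apply Hc; split; [|assumption].
      apply lt_succ, pair_le_mono; [apply le_refl|apply lt_succ, Hb].
    (* At length [pair m a] the path has to cover [a] already. *)
    + intros a Ha. destruct (HD (pair m a)) as (c & [_ Hc] & Hs).
      apply HTp in Hs as (_ & _ & Hcov).
      destruct (Hcov a) as (i & Hi & Hia); trivial.
      { apply lt_succ, le_pair_r. }
      { apply le_refl. }
      exists i; split; [assumption|]. apply Hc, Hia.
Qed.

Lemma in_ideal_of_small m (X : sets M) :
  (forall n x, codes x (fun i => i < n /\ mem i X) -> small m x) -> J X.
Proof.
  intros H. destruct (pieces_ex m X H) as (D & HD & Hcov).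
  (* The union includes the index [m], whose section is empty. *)
  destruct (ideal_union J HJ m D) as (Y & HY & E).
  { intros i _. apply (piece_in_ideal m), HD. }
  apply (ideal_subset J HJ X Y); [|assumption].
  intros a Ha. apply E. destruct (Hcov a Ha) as (i & Hi & Hia).
  exists i; split; [left|]; assumption.
Qed.


(** * The submeasure *)

Definition norm x n : Prop := small n x /\ forall k, k < n -> ~ small k x.

Lemma norm_ex x : exists n, norm x n.
Proof.
  (* The least number principle is for $\Delta^0_0$ predicates, so the $\Delta^0_1$ predicate is
     first replaced by a set. *)
  destruct (comprehension (fun k => small k x)) as [X HX].
  { apply (delta1_subst _ (fun e => e 0%nat .: x .: e) delta1_small).
    intros [|[|u]]; simpl; tm. }
  destruct (least_number (fun k => mem k X)) as (n & Hn & Hmin).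
  - delta0.
  - destruct (small_ex x) as [k Hk]. exists k; apply HX, Hk.
  - exists n; split; [apply HX, Hn|]. intros k Hk; rewrite <- HX; auto.
Qed.

Lemma norm_le x n k : norm x n -> small k x -> n <= k.
Proof.
  intros [_ Hmin] Hk. destruct (lt_or_ge k n) as [L|L]; [|assumption].
  destruct (Hmin k L Hk).
Qed.

Lemma norm_unique x n n' : norm x n -> norm x n' -> n = n'.
Proof.
  intros H H'.
  destruct (norm_le x n n' H (proj1 H')) as [L| ->]; [|reflexivity].
  destruct (proj2 H' n L (proj1 H)).
Qed.

Lemma norm_empty x : (forall a, ~ fin_mem a x) -> norm x 0.
Proof.
  intros Hx; split; [|intros k Hk; destruct (not_lt_0 _ Hk)].
  (* The empty set serves as its own cover. *)
  exists x; split; [intros i a Hp; destruct (Hx _ Hp)|intros a Ha; destruct (Hx a Ha)].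
Qed.

(** [pair (pair n 0) 0] codes the rational [n], which is used as the approximation at every [k]. *)
Lemma norm_graph_ex : exists mu : sets M, forall x k q,
  mem (pair (pair x k) q) mu <-> exists n, norm x n /\ q = pair (pair n 0) 0.
Proof.
  destruct (comprehension (fun t => exists x, x < t + 1 /\ exists k, k < t + 1 /\
    exists n, n < t + 1 /\ t = pair (pair x k) (pair (pair n 0) 0) /\ norm x n)) as [mu Hmu].
  { unfold norm; delta1.
    - apply (delta1_2 small (fun e => e 0%nat) (fun e => e 2%nat)); [apply delta1_small|tm|tm].
    - apply (delta1_2 small (fun e => e 0%nat) (fun e => e 3%nat)); [apply delta1_small|tm|tm]. }
  exists mu; intros x k q. rewrite Hmu; split.
  - intros (x' & _ & k' & _ & n & _ & E & Hn).
    apply pair_inj in E as [E ->]. apply pair_inj in E as [-> _]. eauto.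
  - intros (n & Hn & ->).
    exists x; split; [|exists k; split; [|exists n; split; [|auto]]]; apply lt_succ.
    + eapply le_trans; apply le_pair_l.
    + eapply le_trans; [apply le_pair_r|apply le_pair_l].
    + eapply le_trans; [|apply le_pair_r]. eapply le_trans; apply le_pair_l.
Qed.

(** * Verification of the submeasure and of its finiteness ideal *)

Section Submeasure.
Context (mu : sets M) (Hmu : forall x k q,
  mem (pair (pair x k) q) mu <-> exists n, norm x n /\ q = pair (pair n 0) 0).

Lemma represents_norm x n : norm x n -> represents mu x (real_of_num n).
Proof.
  intros Hn k q. rewrite Hmu; split.
  - intros (n' & Hn' & ->). rewrite (norm_unique x n n' Hn Hn'); reflexivity.
  - intros ->. exists n; auto.
Qed.

(** Values of [mu] are literally constant sequences, so comparing them reduces to comparing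
    integers. *)
Lemma represents_inv x r : represents mu x r ->
  exists n, norm x n /\ forall k, r k = Rat n 0 0.
Proof.
  intros H. destruct (norm_ex x) as [n Hn]. exists n; split; [assumption|]. intros k.
  assert (E : pair (pair n 0) 0 = rat_code (r k)).
  { apply H, Hmu. exists n; auto. }
  destruct (r k) as [p q d]; unfold rat_code in E; simpl in E. apply pair_inj in E as [E <-].
  apply pair_inj in E as [<- <-]. reflexivity.
Qed.

(** The slack [a] stands for the numerator 1 in [is_real] and 2 in [real_le]. *)
Lemma rat_le_num m n k a : m <= n -> rat_le (Rat m 0 0) (rat_add (Rat n 0 0) (Rat a 0 k)).
Proof.
  intros H. apply le_iff in H as [z ->]. apply le_iff; simpl.
  exists (z * (k + 1) + a); ring.
Qed.

Lemma real_le_num (r s : num M -> rat M) m n : (forall k, r k = Rat m 0 0) ->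
  (forall k, s k = Rat n 0 0) -> m <= n -> real_le r s.
Proof. intros Hr Hs H k. rewrite Hr, Hs. apply rat_le_num, H. Qed.

(** Only the approximation at 0 is compared, where [real_le] allows an error of 2. The loss is
    harmless because only boundedness of the values is at stake. *)
Lemma num_le_of_real_le (r : num M -> rat M) m n : (forall k, r k = Rat m 0 0) ->
  real_le r (real_of_num n) -> m <= n + 2.
Proof.
  intros Hr H. specialize (H 0). rewrite Hr in H.
  apply le_iff in H as [z Hz]; simpl in Hz. apply le_iff; exists z.
  transitivity ((n * (0 + 1) + 2 * (0 + 1)) * (0 + 1) + 0 * (0 * 0 + 0 + 0 + 1));
    [ring|rewrite Hz; ring].
Qed.

Lemma submeasure_norm : submeasure mu.
Proof.
  split.
  - intros x _. destruct (norm_ex x) as [n Hn]. exists (real_of_num n).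
    split; [apply represents_norm, Hn|]. intros k i; split; apply rat_le_num, le_refl.
  - intros x r [_ Hx] Hr. apply represents_inv in Hr as (n & Hn & Hr).
    assert (E : n = 0).
    { apply (norm_unique x); [assumption|apply norm_empty; intros a Ha; apply (Hx a), Ha]. }
    split; eapply real_le_num; try apply Hr; try reflexivity; rewrite E; apply le_refl.
  - intros x y z r s t _ _ [_ Hz] Hr Hs Ht.
    apply represents_inv in Hr as (m & Hm & Hr). apply represents_inv in Hs as (n & Hn & Hs).
    apply represents_inv in Ht as (u & Hu & Ht).
    repeat split.
    + apply (real_le_num _ _ m u Hr Ht), (norm_le x); [assumption|].
      apply (small_mono u u z); [apply Hu|apply le_refl|]. intros a Ha; apply Hz; auto.
    + apply (real_le_num _ _ n u Hs Ht), (norm_le y); [assumption|].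
      apply (small_mono u u z); [apply Hu|apply le_refl|]. intros a Ha; apply Hz; auto.
    + apply (real_le_num _ _ u (m + n) Ht).
      * intros k. unfold real_add. rewrite Hr, Hs. unfold rat_add; simpl. f_equal; ring.
      * apply (norm_le z); [assumption|].
        apply (small_union m n x y); [apply Hm|apply Hn|intros a; apply Hz].
Qed.

Lemma integer_valued_norm : integer_valued mu.
Proof.
  intros x _. destruct (norm_ex x) as [n Hn]. exists (real_of_num n), n.
  split; [apply represents_norm, Hn|]. split; intros k; apply rat_le_num, le_refl.
Qed.

Lemma Fin_norm (X : sets M) : J X <-> Fin mu X.
Proof.
  split.
  - intros HX. apply HU in HX as [j Hj]. exists (j + 1); intros n.
    destruct (Hj n) as (x & Hx & _). destruct (norm_ex x) as [m Hm].
    exists x, (real_of_num m). split; [assumption|]. split; [apply represents_norm, Hm|].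
    apply (real_le_num _ _ m (j + 1)); try reflexivity.
    apply (norm_le x); [assumption|]. apply (small_path j X); [assumption|].
    intros a Ha; apply Hx, Ha.
  - intros [m H]. apply (in_ideal_of_small (m + 2)). intros n x [_ Hx].
    destruct (H n) as (y & r & [_ Hy] & Hr & Hle).
    apply represents_inv in Hr as (u & [Hu _] & Hr).
    apply (small_mono u _ y); [assumption|apply (num_le_of_real_le r); assumption|].
    intros a Ha. apply Hy, Hx, Ha.
Qed.

End Submeasure.
End Arithmetic.

Theorem theorem4 :
  forall M : L2_structure,
    WKL0 M -> BSigma02 M ->
    forall J : sets M -> Prop,
      free_F_sigma_ideal J ->
      exists mu : sets M,
        submeasure mu /\ integer_valued mu /\
        forall X : sets M, J X <-> Fin mu X.
Proof.
  intros M [HM HW] _ J [HJ (U & HT & HU)].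
  destruct (norm_graph_ex HM U HT) as [mu Hmu].
  exists mu; split; [|split].
  - eapply submeasure_norm; eassumption.
  - eapply integer_valued_norm; eassumption.
  - eapply Fin_norm; eassumption.
Qed.
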